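(* Let $(q_n)_{n\in\mathbb{N}}$ be a real-valued lacunary sequence. Suppose that $\mu$ is a probability measure on $[0,1)$ such that, for some $\eta>0$, $$\widehat{\mu}(t) \ll \frac{1}{(1+|t|)^{\eta}}, \qquad |t|\to\infty .$$ Then there exists a constant $C>0$, depending on $(q_n)_{n\in\mathbb{N}}$, such that for $\mu$-almost all $x\in[0,1)$ the following holds: for every $\delta\in[0,1)$, $$\|q_n x-\delta\|<\frac{C}{n}\qquad\text{for infinitely many } n\geq 1 .$$
   Context: $\|y\|$ denotes the distance from $y\in\mathbb{R}$ to the nearest integer. A real-valued sequence $(q_n)_{n\in\mathbb{N}}$ is called lacunary if there is a fixed $r>1$ such that $q_{n+1}/q_n\geq r$ for all $n\geq 1$. The Fourier transform of $\mu$ is $\widehat{\mu}(t)=\int_0^1 e(tu)\,d\mu(u)$ for $t\in\mathbb{R}$, where $e(u)=e^{2\pi i u}$. The relation $f\ll g$ means $|f|\leq c\,g$ for some constant $c>0$, for all sufficiently large $|t|$. The exceptional $\mu$-null set of $x$ does not depend on $\delta$. *)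

(* Defs.v *)
From HB Require Import structures.
From mathcomp Require Export all_boot all_order all_algebra.
From mathcomp Require Export all_classical all_reals all_analysis.
From mathcomp.real_closed Require Export complex.

Set Implicit Arguments.
Unset Strict Implicit.
Unset Printing Implicit Defensive.

Export Order.TTheory GRing.Theory Num.Theory.
Export numFieldNormedType.Exports.

Local Open Scope classical_set_scope.
Local Open Scope ring_scope.
Local Open Scope complex_scope.

Definition dist_nearest_int (R : realType) (y : R) : R :=
  inf [set `|y - m%:~R| | m in [set: int]].

(* Sequences are indexed by n >= 1; the value q 0 is ignored.  Since x / 0 = 0,
   the inequality r <= q n.+1 / q n with 1 < r forces q n != 0, as the informal
   quotient presupposes. Negative sequences are allowed. *)
Definition lacunary (R : realType) (q : nat -> R) : Prop :=
  exists r : R, 1 < r /\ forall n : nat, (1 <= n)%N -> r <= q n.+1 / q n.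

Definition expi (R : realType) (u : R) : R[i] :=
  cos (2 * pi * u) +i* sin (2 * pi * u).

(* The integral of the complex-valued function u |-> e(t u) is taken
   componentwise. *)
Definition fourier (R : realType) (mu : probability (measurableTypeR R) R)
    (t : R) : R[i] :=
  (\int[mu]_(u in `[0, 1[) complex.Re (expi (t * u))) +i*
  (\int[mu]_(u in `[0, 1[) complex.Im (expi (t * u))).

Definition vinogradov_at_infty (R : realType) (f : R -> R[i]) (g : R -> R) :
    Prop :=
  exists c : R, 0 < c /\
    exists T : R, forall t : R, T <= `|t| -> `|f t| <= (c * g t)%:C.

(* Main.v *)
Require Import Defs.
From mathcomp Require Import ring lra zify.

(** The statement is a Dvoretzky covering theorem: the arcs of radius C/n around
    the points q_n x have divergent total length, so for a large C they cover
    the circle again and again, for almost every x.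

    Take all q_n positive, fix a scale N = 2^k, and look at indices between N
    and roughly N^3.  If the points q_n x were independent and uniform, a fixed
    delta would be missed by all of their arcs with probability N^(-p), where p
    grows with C.  As soon as p > 3, the union bound over a grid of mesh 1/N^3
    is summable in k; Borel-Cantelli then gives, for almost every x, that at all
    large scales every grid point, hence every delta, is approximated.

    Independence is replaced by the decay of the Fourier transform.
    - arc_minorant gives a trigonometric polynomial of degree less than 2D and
      mean 1 that is nonpositive off an arc of radius comparable to 1/D.  If S
      is the sum of its values at q_n x - delta along a block of L consecutive
      indices, then S <= 0 on the event that the whole block avoids delta, so
      (1 - a S)^2 >= 1 there.
    - The mean of S is L, and lacunarity makes its second moment O(L D): the
      frequencies k q_n and l q_m of two terms almost cancel for only
      O(D r^(-|n-m|)) pairs (k, l).  Choosing a of order 1/D, the majorant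
      (1 - a S)^2 is at most 1 - const L/D plus a remainder with large
      frequencies only (block_majorant).
    - The blocks have length L of order log N and are separated by gaps of the
      same length, which makes the frequencies of a block dominate all those of
      the preceding ones.  Multiplying the majorants therefore multiplies the
      main terms, up to errors controlled by the values of the Fourier
      transform at frequencies of size q_n, which are exponentially small in n
      (riesz_product).  The main terms 1 - const L/D telescope into a power of
      N over the last index.
    - The gain per block depends on r only; the exponent eta only decides how
      large k must be.  This is why C depends on the sequence alone.

    Negative q_n reduce to positive ones by changing the sign of delta. *)

Set Implicit Arguments.
Unset Strict Implicit.
Unset Printing Implicit Defensive.

Local Open Scope classical_set_scope.
Local Open Scope ring_scope.

(** * A trigonometric minorant of a short arc *)

Section Kernel.
Context {R : realType}.
Implicit Types (u x y : R) (D k l m n : nat).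

Lemma cosMcos x y : cos x * cos y = (cos (x + y) + cos (x - y)) / 2.
Proof. by rewrite cosD cosB; field. Qed.

Lemma sum_subsingleton_le (I : finType) (P : pred I) (f : I -> R) (c : R) :
  (forall i j, P i -> P j -> i = j) -> (forall i, P i -> f i <= c) -> 0 <= c ->
  \sum_(i | P i) f i <= c.
Proof.
move=> inj fc c0; case: (pickP P) => [i Pi|P0]; last by rewrite big_pred0.
rewrite (bigD1 i Pi) /= big1 ?addr0; first exact: fc.
by move=> j /andP[Pj /eqP[]]; apply: inj.
Qed.

(** Grouping equal frequencies: this is how coefficients of products of cosine
    sums are read off without any indexing by convolution. *)
Lemma collect_cos (I : finType) (w : I -> R) (nu : I -> nat) M u :
  (forall i, nu i < M)%N ->
  \sum_i w i * cos ((nu i)%:R * u) =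
  \sum_(m < M) (\sum_(i | nu i == m) w i) * cos (m%:R * u).
Proof.
move=> nuM.
rewrite (partition_big (fun i => Ordinal (nuM i)) predT) //=.
apply: eq_bigr => m _; rewrite mulr_suml.
by apply: eq_big => i; [rewrite -val_eqE|move=> /eqP <-].
Qed.

(** D times the cosine coefficients of the Fejer kernel: D - |k| for the
    frequencies k and -k together. *)
Definition fejer_coef D k : R := if k == 0%N then D%:R else 2 * (D - k)%:R.

Definition fejer D u : R := \sum_(k < D) fejer_coef D k * cos (k%:R * u).

Lemma fejer_coefS D k : (k <= D)%N ->
  fejer_coef D.+1 k = fejer_coef D k + (if k == 0%N then 1 else 2).
Proof.
rewrite /fejer_coef; case: eqP => [_ _|_ kD]; first by rewrite -natr1.
by rewrite subSn // -natr1; ring.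
Qed.

Lemma fejer_coefD D : fejer_coef D D = 0.
Proof. by rewrite /fejer_coef subnn mulr0; case: eqP => // ->. Qed.

Lemma fejer_coef_ge0 D k : 0 <= fejer_coef D k.
Proof. by rewrite /fejer_coef; case: eqP => _; rewrite ?mulr_ge0. Qed.

Lemma fejer_coef_le D k : fejer_coef D k <= 2 * D%:R.
Proof.
have D0 : 0 <= D%:R :> R by [].
rewrite /fejer_coef; case: eqP => _; first by lra.
by rewrite ler_pM2l // ler_nat leq_subr.
Qed.

Lemma sum_fejer_coefS D (c : nat -> R) :
  \sum_(k < D.+1) fejer_coef D.+1 k * c k =
  \sum_(k < D) fejer_coef D k * c k +
  \sum_(k < D.+1) (if k == 0%N :> nat then 1 else 2) * c k.
Proof.
transitivity (\sum_(k < D.+1) fejer_coef D k * c k +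
  \sum_(k < D.+1) (if k == 0%N :> nat then 1 else 2) * c k).
  rewrite -big_split; apply: eq_bigr => k _ /=.
  by rewrite fejer_coefS ?mulrDl //; have := ltn_ord k; rewrite ltnS.
by rewrite big_ord_recr /= fejer_coefD mul0r addr0.
Qed.

Lemma sum_fejer_coef D : \sum_(k < D) fejer_coef D k = D%:R ^+ 2.
Proof.
elim: D => [|D IH]; first by rewrite big_ord0 expr0n.
have := sum_fejer_coefS D (fun=> 1).
under eq_bigr do rewrite mulr1.
move=> ->; under eq_bigr do rewrite mulr1.
rewrite IH big_ord_recl /=.
under eq_bigr do rewrite mulr1.
rewrite sumr_const card_ord -natr1 -mulr_natr; ring.
Qed.

(** Cauchy-Schwarz for the D coefficients, whose sum is D^2. *)
Lemma sum_fejer_coef_sqr D : D%:R ^+ 3 <= \sum_(k < D) fejer_coef D k ^+ 2.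
Proof.
have : 0 <= \sum_(k < D) (fejer_coef D k - D%:R) ^+ 2.
  by apply: sumr_ge0 => k _; exact: sqr_ge0.
under eq_bigr do rewrite sqrrB.
rewrite big_split sumrB /= sumr_const card_ord.
rewrite sumrMnl -mulr_suml.
rewrite sum_fejer_coef -[_ *+ 2]mulr_natr -[_ *+ D]mulr_natr; lra.
Qed.

Lemma dirichlet_eq D u :
  (1 - cos u) *
    (\sum_(k < D.+1) (if k == 0%N :> nat then 1 else 2) * cos (k%:R * u)) =
  cos (D%:R * u) - cos (D.+1%:R * u).
Proof.
elim: D => [|D IH].
  by rewrite big_ord_recl big_ord0 /= !mul0r !mul1r cos0; ring.
rewrite big_ord_recr /= mulrDr IH.
have -> : D.+2%:R * u = D.+1%:R * u + u by rewrite -[D.+2%:R]natr1; ring.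
have -> : D%:R * u = D.+1%:R * u - u by rewrite -[D.+1%:R]natr1; ring.
by rewrite cosB cosD; ring.
Qed.

(** The closed form of the Fejer kernel; summing Dirichlet kernels telescopes.
    Multiplying the square of the kernel by 1 - cos u thus leaves one kernel
    times a bounded trigonometric polynomial, so coefficients of order D^3 drop
    to order D. *)
Lemma fejer_eq D u : (1 - cos u) * fejer D u = 1 - cos (D%:R * u).
Proof.
elim: D => [|D IH]; first by rewrite /fejer big_ord0 !mul0r mulr0 cos0 subrr.
rewrite /fejer (sum_fejer_coefS D (fun k => cos (k%:R * u))) mulrDr.
by rewrite -/(fejer D u) IH dirichlet_eq; ring.
Qed.

Definition absdiff k l := ((k - l) + (l - k))%N.

Lemma cos_absdiff k l u : cos ((absdiff k l)%:R * u) = cos (k%:R * u - l%:R * u).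
Proof.
rewrite /absdiff; have [kl|lk] := leqP k l.
  have -> : (k - l = 0)%N by lia.
  by rewrite add0n natrB // -cosN; congr cos; ring.
have -> : (l - k = 0)%N by lia.
by rewrite addn0 natrB ?(ltnW lk) //; congr cos; ring.
Qed.

(** Frequencies in the square of the kernel: cos * cos produces the sum
    ([true]) and the difference ([false]) of the two frequencies. *)
Definition fejer_sqr_freq D (i : bool * ('I_D * 'I_D)) : nat :=
  if i.1 then (i.2.1 + i.2.2)%N else absdiff i.2.1 i.2.2.

Definition fejer_sqr_coef D m : R :=
  \sum_(i : bool * ('I_D * 'I_D) | fejer_sqr_freq i == m)
    fejer_coef D i.2.1 * fejer_coef D i.2.2 / 2.

Lemma fejer_sqrE D u :
  fejer D u ^+ 2 = \sum_(m < D.*2) fejer_sqr_coef D m * cos (m%:R * u).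
Proof.
rewrite -collect_cos; last first.
  by case=> [[] [[k kD] [l lD]]]; rewrite /fejer_sqr_freq /absdiff /=; lia.
rewrite /fejer expr2 mulr_suml.
under eq_bigr do rewrite mulr_sumr.
rewrite pair_big /=.
rewrite -(pair_bigA _ (fun (b : bool) (i : 'I_D * 'I_D) =>
  fejer_coef D i.1 * fejer_coef D i.2 / 2 *
   cos ((@fejer_sqr_freq D (b, i))%:R * u))) /=.
rewrite big_bool /= -big_split /=; apply: eq_bigr => -[k l] _ /=.
rewrite mulrACA cosMcos /fejer_sqr_freq /= cos_absdiff natrD [(_ + _) * u]mulrDl.
by field.
Qed.

(** The constant term collects the diagonal of the difference frequencies. *)
Lemma fejer_sqr_coef0 D : D%:R ^+ 3 / 2 <= fejer_sqr_coef D 0.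
Proof.
rewrite /fejer_sqr_coef big_mkcond /=.
rewrite -(pair_bigA _ (fun (b : bool) (i : 'I_D * 'I_D) =>
  if @fejer_sqr_freq D (b, i) == 0%N then
  fejer_coef D i.1 * fejer_coef D i.2 / 2 else 0)) /= big_bool /=.
have h b (i : 'I_D * 'I_D) : 0 <= if fejer_sqr_freq (b, i) == 0%N then
  fejer_coef D i.1 * fejer_coef D i.2 / 2 else 0.
  by case: ifP => // _; rewrite !mulr_ge0 ?invr_ge0 ?fejer_coef_ge0.
apply: (@le_trans _ _ (0 + \sum_(i : 'I_D) fejer_coef D i ^+ 2 / 2)).
  by rewrite add0r -mulr_suml ler_wpM2r ?invr_ge0 // sum_fejer_coef_sqr.
apply: lerD; first by apply: sumr_ge0.
rewrite -(pair_bigA _ (fun k l : 'I_D =>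
    if @fejer_sqr_freq D (false, (k, l)) == 0%N
  then fejer_coef D k * fejer_coef D l / 2 else 0)) /=.
apply: ler_sum => k _; rewrite (bigD1 k) //= -[leLHS]addr0; apply: lerD.
  by rewrite /fejer_sqr_freq /absdiff /= subnn /= expr2.
by apply: sumr_ge0 => l _; exact: h false (k, l).
Qed.

Lemma fejer_sqr_coef_ge0 D m : 0 <= fejer_sqr_coef D m.
Proof.
by apply: sumr_ge0 => i _; rewrite !mulr_ge0 ?invr_ge0 ?fejer_coef_ge0.
Qed.

(** For given k at most one l solves k + l = m and at most two solve
    |k - l| = m. *)
Lemma fejer_sqr_coef_le D m : fejer_sqr_coef D m <= 3 * D%:R ^+ 3.
Proof.
set t := fejer_coef D; have t0 k : 0 <= t k := fejer_coef_ge0 D k.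
have tM k : t k <= 2 * D%:R := fejer_coef_le D k.
have D0 : 0 <= D%:R :> R by [].
have one (P : pred 'I_D) : (forall i j, P i -> P j -> i = j) ->
    \sum_(l | P l) t l <= 2 * D%:R.
  by move=> inj; apply: sum_subsingleton_le => // i _; exact: tM.
rewrite /fejer_sqr_coef big_mkcond /=.
rewrite -(pair_bigA _ (fun (b : bool) (i : 'I_D * 'I_D) =>
  if @fejer_sqr_freq D (b, i) == m then
  t i.1 * t i.2 / 2 else 0)) /= big_bool /=.
have -> : 3 * D%:R ^+ 3 = \sum_(k < D) t k * D%:R +
                          \sum_(k < D) t k * (2 * D%:R) :> R.
  by rewrite -!mulr_suml sum_fejer_coef; ring.
have aux (k : 'I_D) (P : pred 'I_D) :
   \sum_l (if P l then t k * t l / 2 else 0) = t k / 2 * \sum_(l | P l) t l.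
  by rewrite -big_mkcond mulr_sumr; apply: eq_bigr => l _; ring.
have half k (s c : R) : s <= 2 * c -> t k / 2 * s <= t k * c.
  by move=> /(ler_wpM2l (t0 k)); lra.
apply: lerD.
  rewrite -(pair_bigA _ (fun k l : 'I_D =>
    if @fejer_sqr_freq D (true, (k, l)) == m
    then t k * t l / 2 else 0)) /=.
  apply: ler_sum => k _; rewrite aux; apply: half; apply: one => i j.
  rewrite /fejer_sqr_freq /= => /eqP <- /eqP.
  by move=> /addnI/val_inj.
rewrite -(pair_bigA _ (fun k l : 'I_D =>
    if @fejer_sqr_freq D (false, (k, l)) == m
    then t k * t l / 2 else 0)) /=.
apply: ler_sum => k _; rewrite aux; apply: half.
have : \sum_(l | @fejer_sqr_freq D (false, (k, l)) == m) t l <=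
       \sum_(l < D | l == (k + m)%N :> nat) t l +
       \sum_(l < D | (l + m)%N == k :> nat) t l.
  rewrite [leLHS]big_mkcond [X in _ <= X + _]big_mkcond.
  rewrite [X in _ <= _ + X]big_mkcond -big_split; apply: ler_sum => l _ /=.
  rewrite /fejer_sqr_freq /absdiff /=; have := t0 l.
  case: eqP => [e|_]; last first.
    by move=> ?; apply: addr_ge0; case: ifP.
  have [->|->] : ((l : nat) = k + m)%N \/ ((l + m)%N = k) by lia.
    by rewrite eqxx => ?; rewrite lerDl; case: ifP.
  by rewrite eqxx => ?; rewrite lerDr; case: ifP.
have : \sum_(l < D | l == (k + m)%N :> nat) t l <= 2 * D%:R.
  by apply: one => i j /eqP ei /eqP ej; apply: val_inj; rewrite /= ei ej.
have : \sum_(l < D | (l + m)%N == k :> nat) t l <= 2 * D%:R.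
  apply: one => i j /eqP <- /eqP; move=> /addIn e.
  by apply: val_inj.
by lra.
Qed.


Definition shift_freq D (i : bool * 'I_D) : nat :=
  if i.1 then (D + i.2)%N else (D - i.2)%N.

Definition shift_coef D m : R :=
  \sum_(i : bool * 'I_D | shift_freq i == m) fejer_coef D i.2 / 2.

Lemma fejer_shiftE D u :
  cos (D%:R * u) * fejer D u =
  \sum_(m < D.*2) shift_coef D m * cos (m%:R * u).
Proof.
rewrite -collect_cos; last first.
  by case=> [[] [k kD]]; rewrite /shift_freq /=; lia.
rewrite -(pair_bigA _ (fun (b : bool) (k : 'I_D) => fejer_coef D k / 2 *
   cos ((@shift_freq D (b, k))%:R * u))) /=.
rewrite big_bool /= -big_split /fejer mulr_sumr; apply: eq_bigr => k _ /=.
rewrite mulrCA cosMcos /shift_freq /= natrD natrB ?(ltnW (ltn_ord k)) //.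
by rewrite mulrBl [(_ + _) * u]mulrDl; field.
Qed.

Lemma shift_coef0 D : shift_coef D 0 = 0.
Proof.
rewrite /shift_coef big_pred0 // => -[b k]; rewrite /shift_freq /=.
by have := ltn_ord k; case: b; lia.
Qed.

Lemma shift_coef_ge0 D m : 0 <= shift_coef D m.
Proof. by apply: sumr_ge0 => i _; rewrite mulr_ge0 ?invr_ge0 ?fejer_coef_ge0. Qed.

Lemma shift_coef_le D m : shift_coef D m <= 2 * D%:R.
Proof.
have D0 : 0 <= D%:R :> R by [].
rewrite /shift_coef big_mkcond /=.
rewrite -(pair_bigA _ (fun (b : bool) (k : 'I_D) =>
   if @shift_freq D (b, k) == m then fejer_coef D k / 2 else 0)) /= big_bool /=.
have tM (k : 'I_D) : fejer_coef D k / 2 <= D%:R :> R.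
  by have := @fejer_coef_le D k; lra.
have -> : 2 * D%:R = D%:R + D%:R :> R by ring.
rewrite -!big_mkcond /shift_freq /=.
by apply: lerD; apply: sum_subsingleton_le => // i j /eqP ei /eqP ej;
  have := ltn_ord i; have := ltn_ord j => ? ?; apply: val_inj => /=; lia.
Qed.

(** Cosine coefficients of (cos u - 1 + 4/D^2) * fejer D u ^+ 2.  The first
    factor makes the function nonpositive off a short arc; the square of the
    kernel is concentrated enough there for the mean to stay positive. *)
Definition minorant_coef D m : R :=
  shift_coef D m - (if (m < D)%N then fejer_coef D m else 0)
  + 4 / D%:R ^+ 2 * fejer_sqr_coef D m.

Lemma minorantE D u :
  (cos u - 1 + 4 / D%:R ^+ 2) * fejer D u ^+ 2 =
  \sum_(m < D.*2) minorant_coef D m * cos (m%:R * u).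
Proof.
have -> : (cos u - 1 + 4 / D%:R ^+ 2) * fejer D u ^+ 2 =
    - ((1 - cos u) * fejer D u) * fejer D u + 4 / D%:R ^+ 2 * fejer D u ^+ 2.
  by ring.
have -> : - ((1 - cos u) * fejer D u) * fejer D u =
   cos (D%:R * u) * fejer D u - fejer D u by rewrite fejer_eq; ring.
rewrite fejer_shiftE fejer_sqrE mulr_sumr.
have -> : fejer D u = \sum_(m < D.*2)
   (if (m < D)%N then fejer_coef D m else 0) * cos (m%:R * u).
  rewrite /fejer (big_ord_widen_cond _ predT
    (fun k => fejer_coef D k * cos (k%:R * u)) (_ : D <= D.*2)%N); last by lia.
  rewrite big_mkcond; apply: eq_bigr => k _ /=.
  by case: ifP; rewrite ?mul0r.
rewrite -sumrB -big_split; apply: eq_bigr => m _ /=.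
by rewrite /minorant_coef; ring.
Qed.

Lemma minorant_coef0 D : (0 < D)%N -> D%:R <= minorant_coef D 0.
Proof.
move=> D0; rewrite /minorant_coef shift_coef0 D0 /fejer_coef eqxx.
have D0' : D%:R != 0 :> R by rewrite pnatr_eq0 -lt0n.
have : 4 / D%:R ^+ 2 * (D%:R ^+ 3 / 2) <= 4 / D%:R ^+ 2 * fejer_sqr_coef D 0.
  by rewrite ler_wpM2l ?fejer_sqr_coef0 // divr_ge0 // sqr_ge0.
have -> : 4 / D%:R ^+ 2 * (D%:R ^+ 3 / 2) = 2 * D%:R :> R by field.
lra.
Qed.

Lemma minorant_coef_le D m : (0 < D)%N -> `|minorant_coef D m| <= 16 * D%:R.
Proof.
move=> D0; have D0' : D%:R != 0 :> R by rewrite pnatr_eq0 -lt0n.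
have D0'' : 0 <= D%:R :> R by [].
have h : 4 / D%:R ^+ 2 * fejer_sqr_coef D m <=
         4 / D%:R ^+ 2 * (3 * D%:R ^+ 3).
  by rewrite ler_wpM2l ?fejer_sqr_coef_le // divr_ge0 // sqr_ge0.
have e : 4 / D%:R ^+ 2 * (3 * D%:R ^+ 3) = 12 * D%:R :> R by field.
have h0 : 0 <= 4 / D%:R ^+ 2 * fejer_sqr_coef D m.
  by rewrite mulr_ge0 ?fejer_sqr_coef_ge0 // divr_ge0 // sqr_ge0.
have := shift_coef_ge0 D m; have := shift_coef_le D m.
have : 0 <= (if (m < D)%N then fejer_coef D m else 0) <= 2 * D%:R.
  case: ifP => _; rewrite ?fejer_coef_ge0 ?fejer_coef_le //.
  by rewrite lexx mulr_ge0.
move=> /andP[? ?] ? ?; rewrite /minorant_coef ler_norml; apply/andP; split; lra.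
Qed.

(** The mean of the minorant is at least D while each coefficient is at most
    16 D, so after division by the mean all coefficients are bounded by an
    absolute constant.  This uniform bound, rather than the mere existence of a
    minorant, is what keeps the second moment along a block proportional to
    the degree. *)
Lemma arc_minorant D : (0 < D)%N ->
  exists b : nat -> R, (forall k, `|b k| <= 16) /\
    forall u, cos u <= 1 - 4 / D%:R ^+ 2 ->
      1 + \sum_(k < D.*2.-1) b k * cos (k.+1%:R * u) <= 0.
Proof.
move=> D0; have g0 := minorant_coef0 D0.
have D1 : 0 < D%:R :> R by rewrite ltr0n.
have gp : 0 < minorant_coef D 0 by exact: lt_le_trans g0.
exists (fun k => minorant_coef D k.+1 / minorant_coef D 0); split.
  move=> k; rewrite normrM normfV [X in _ / X]gtr0_norm // ler_pdivrMr //.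
  by apply: (le_trans (minorant_coef_le _ D0)); rewrite ler_pM2l.
move=> u hu.
have : (cos u - 1 + 4 / D%:R ^+ 2) * fejer D u ^+ 2 <= 0.
  by rewrite mulr_le0_ge0 ?sqr_ge0 //; lra.
rewrite minorantE; have -> : D.*2 = D.*2.-1.+1 by lia.
rewrite big_ord_recl /= mul0r cos0 mulr1 => h.
rewrite -(pmulr_rle0 _ gp) mulrDr mulr1; apply: le_trans h.
rewrite lerD2l le_eqVlt; apply/orP; left; apply/eqP.
rewrite mulr_sumr; apply: eq_bigr => k _.
by rewrite mulrA mulrCA divff ?mulr1 ?gt_eqF.
Qed.

End Kernel.

(** * Trigonometric polynomials with real frequencies *)

Section TrigPoly.
Context {R : realType}.
Implicit Types (lo hi A B w phi c : R) (f g : R -> R).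

(** [trig_poly lo hi A f]: f is a finite combination of cosines with absolute
    frequencies in [lo, hi] and total weight at most A.  Presenting the class by
    its closure rules lets each property of such functions be checked by
    induction, with no list of coefficients to manipulate. *)
Inductive trig_poly lo hi : R -> (R -> R) -> Prop :=
| trig_poly0 : trig_poly lo hi 0 (fun=> 0)
| trig_poly_cos w phi : lo <= `|w| <= hi ->
    trig_poly lo hi 1 (fun x => cos (2 * pi * (w * x) + phi))
| trig_polyZ c A f : trig_poly lo hi A f ->
    trig_poly lo hi (`|c| * A) (fun x => c * f x)
| trig_polyD A B f g : trig_poly lo hi A f -> trig_poly lo hi B g ->
    trig_poly lo hi (A + B) (fun x => f x + g x)
| trig_polyW A B f g : trig_poly lo hi A f -> A <= B -> f =1 g ->
    trig_poly lo hi B g.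

Lemma trig_poly_ge0 lo hi A f : trig_poly lo hi A f -> 0 <= A.
Proof.
elim=> {A f} [|//|c A f _ A0|A B f g _ A0 _ B0|A B f g _ A0 AB _] //.
- exact: mulr_ge0.
- exact: addr_ge0.
- exact: le_trans AB.
Qed.

Lemma trig_poly_freqW lo hi lo' hi' A f : lo' <= lo -> hi <= hi' ->
  trig_poly lo hi A f -> trig_poly lo' hi' A f.
Proof.
move=> ll hh; elim=> {A f} [|w phi /andP[? ?]|c A f _ h|A B f g _ hf _ hg|].
- exact: trig_poly0.
- by apply: trig_poly_cos; apply/andP; split; lra.
- exact: trig_polyZ.
- exact: trig_polyD.
- by move=> A B f g _ h AB fg; apply: trig_polyW AB fg.
Qed.

Lemma trig_poly_lo0 lo hi A (f : R -> R) :
  trig_poly lo hi A f -> trig_poly 0 hi A f.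
Proof.
elim=> {A f} [|w phi /andP[_ wh]|c A f _ h|A B f g _ hf _ hg|A B f g _ h AB fg].
- exact: trig_poly0.
- by apply: trig_poly_cos; rewrite normr_ge0.
- exact: trig_polyZ.
- exact: trig_polyD.
- exact: trig_polyW AB fg.
Qed.

Lemma trig_poly_cst c lo hi : lo <= 0 -> 0 <= hi ->
  trig_poly lo hi `|c| (fun=> c).
Proof.
move=> lo0 hi0; have h : trig_poly lo hi 1 (fun x => cos (2 * pi * (0 * x) + 0)).
  by apply: trig_poly_cos; rewrite normr0 lo0.
apply: (trig_polyW (trig_polyZ c h)); first by rewrite mulr1.
by move=> x; rewrite mul0r mulr0 addr0 cos0 mulr1.
Qed.

Lemma trig_poly_sum (I : Type) (r : seq I) (P : pred I) lo hi (A : I -> R)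
    (F : I -> R -> R) :
  (forall i, P i -> trig_poly lo hi (A i) (F i)) ->
  trig_poly lo hi (\sum_(i <- r | P i) A i) (fun x => \sum_(i <- r | P i) F i x).
Proof.
move=> h; elim: r => [|i r IH].
  apply: (trig_polyW (trig_poly0 _ _)); first by rewrite big_nil.
  by move=> x; rewrite big_nil.
have [Pi|Pi] := boolP (P i); last first.
  by apply: (trig_polyW IH) => [|x]; rewrite big_cons (negbTE Pi).
by apply: (trig_polyW (trig_polyD (h i Pi) IH)) => [|x]; rewrite big_cons Pi.
Qed.

(** Frequencies add and subtract in a product, so multiplying by a polynomial
    with frequencies at most h moves the frequency range by at most h. *)
Lemma trig_polyM lo hi h A B f g :
  trig_poly 0 h A f -> trig_poly lo hi B g ->
  trig_poly (lo - h) (hi + h) (A * B) (fun x => f x * g x).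
Proof.
move=> Tf Tg; elim: Tg => {B g} [|v psi /andP[lv vh]|c B g Tg IH||].
- by apply: (trig_polyW (trig_poly0 _ _)) => [|x]; rewrite mulr0.
- elim: Tf => {A f} [|w phi /andP[_ wh]|c A f _ IH|A B f g _ If _ Ig|].
  + by apply: (trig_polyW (trig_poly0 _ _)) => [|x]; rewrite mul0r.
  + have c1 : trig_poly (lo - h) (hi + h) 1
        (fun x => cos (2 * pi * ((w + v) * x) + (phi + psi))).
      apply: trig_poly_cos; have := ler_normD w v.
      have := lerB_dist v (- w); rewrite opprK normrN [v + w]addrC.
      by move=> ? ?; apply/andP; split; lra.
    have c2 : trig_poly (lo - h) (hi + h) 1
        (fun x => cos (2 * pi * ((w - v) * x) + (phi - psi))).
      apply: trig_poly_cos; have := ler_normB w v.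
      have := lerB_dist v w; rewrite distrC.
      by move=> ? ?; apply/andP; split; lra.
    apply: (trig_polyW (trig_polyZ 2^-1 (trig_polyD c1 c2))).
      by rewrite ger0_norm; lra.
    move=> x /=; rewrite cosMcos mulrC; congr ((cos _ + cos _) / 2); ring.
  + by apply: (trig_polyW (trig_polyZ c IH)) => [|x]; rewrite mulrA.
  + by apply: (trig_polyW (trig_polyD If Ig)) => [|x];
      rewrite ?[leRHS]mulrDl ?[RHS]mulrDl.
  + move=> A B f g _ IH AB fg; apply: (trig_polyW IH); first by rewrite !mulr1.
    by move=> x; rewrite fg.
- by apply: (trig_polyW (trig_polyZ c IH)) => [|x]; rewrite mulrCA.
- move=> B C g k _ Ig _ Ik.
  by apply: (trig_polyW (trig_polyD Ig Ik)) => [|x]; rewrite mulrDr.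
- move=> B C g k _ Ig BC gk; apply: (trig_polyW Ig).
    by rewrite ler_wpM2l // (trig_poly_ge0 Tf).
  by move=> x; rewrite gk.
Qed.

Lemma trig_poly_bounded lo hi A f x : trig_poly lo hi A f -> `|f x| <= A.
Proof.
elim=> {A f} [|w phi _|c A f _ h|A B f g _ hf _ hg|A B f g _ h AB fg].
- by rewrite normr0.
- exact: cos_max.
- by rewrite normrM ler_wpM2l.
- by rewrite (le_trans (ler_normD _ _)) // lerD.
- by rewrite -fg (le_trans h).
Qed.

Lemma trig_poly_continuous lo hi A f : trig_poly lo hi A f -> continuous f.
Proof.
elim=> {A f} [|w phi _|c A f _ h|A B f g _ hf _ hg|A B f g _ h AB fg] x.
- exact: cvg_cst.
- apply: (@continuous_comp _ _ _ (fun x => 2 * pi * (w * x) + phi) cos).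
    apply: cvgD; last exact: cvg_cst.
    apply: cvgM; first exact: cvg_cst.
    by apply: cvgM; [exact: cvg_cst|exact: cvg_id].
  exact: continuous_cos.
- by apply: cvgM; [exact: cvg_cst|exact: h].
- by apply: cvgD; [exact: hf|exact: hg].
- by have -> : g = f by apply/funext => y; rewrite fg.
Qed.

Section Integral.
Variable mu : probability (measurableTypeR R) R.

Local Notation I f := (\int[mu]_(x in `[0, 1[) f x).

Lemma trig_poly_integrable lo hi A f : trig_poly lo hi A f ->
  mu.-integrable `[0, 1[ (EFin \o f).
Proof.
move=> Tf; apply: measurable_bounded_integrable => //.
- by rewrite (le_lt_trans (probability_le1 _ _)) // ltry.
- apply: measurable_funTS; apply: measurable_realfun.continuous_measurable_fun.
  exact: trig_poly_continuous Tf.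
- exists A; split; first by rewrite num_real.
  by move=> M AM x _; rewrite /= (le_trans (trig_poly_bounded x Tf)) // ltW.
Qed.

Lemma Rintegral_trig_poly_le lo hi A f E : trig_poly lo hi A f ->
  0 <= E ->
  (forall w phi, lo <= `|w| ->
    `|I (fun x => cos (2 * pi * (w * x) + phi))| <= E) ->
  `|I f| <= A * E.
Proof.
move=> Tf E0 hE; elim: Tf => {A f}
  [|w phi /andP[lw _]|c A f Tf h|A B f g Tf hf Tg hg|A B f g _ h AB fg].
- by rewrite Rintegral_cst // mul0r normr0 mul0r.
- by rewrite mul1r; exact: hE.
- rewrite RintegralZl //; last exact: trig_poly_integrable Tf.
  by rewrite normrM -mulrA ler_wpM2l.
- rewrite RintegralD //;
    [|exact: trig_poly_integrable Tf|exact: trig_poly_integrable Tg].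
  by rewrite (le_trans (ler_normD _ _)) // mulrDl lerD.
- have -> : g = f by apply/funext => x; rewrite fg.
  by rewrite (le_trans h) // ler_wpM2r.
Qed.

Lemma cos_integrable w phi :
  mu.-integrable `[0, 1[ (EFin \o (fun x : R => cos (2 * pi * (w * x) + phi))).
Proof.
apply: (@trig_poly_integrable `|w| `|w| 1).
by apply: trig_poly_cos; rewrite !lexx.
Qed.

Lemma Rintegral_cos_fourier w phi :
  `|I (fun x => cos (2 * pi * (w * x) + phi))| <=
  2 * complex.Re `|fourier mu w|.
Proof.
have e x : cos (2 * pi * (w * x) + phi) =
    cos phi * complex.Re (expi (w * x)) - sin phi * complex.Im (expi (w * x)).
  by rewrite /= cosD; ring.
have ic : mu.-integrable `[0, 1[ (EFin \o (fun x : R => cos (2 * pi * (w * x)))).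
  have := cos_integrable w 0; congr (_.-integrable _ _).
  by apply/funext => x /=; rewrite addr0.
have is' : mu.-integrable `[0, 1[ (EFin \o (fun x : R => sin (2 * pi * (w * x)))).
  have := cos_integrable w (- (pi / 2)); congr (_.-integrable _ _).
  by apply/funext => x /=; rewrite cosBpihalf.
under [X in `|X|]eq_Rintegral => x _ do rewrite e.
rewrite RintegralB //; last 2 first.
- by have := integrableZl _ (cos phi) ic; apply.
- by have := integrableZl _ (sin phi) is'; apply.
rewrite !RintegralZl // normc_def /fourier /=.
set a := Rintegral _ _ _; set b := Rintegral _ _ _.
have ha : `|a| <= Num.sqrt (a ^+ 2 + b ^+ 2).
  by rewrite -sqrtr_sqr ler_wsqrtr // lerDl sqr_ge0.
have hb : `|b| <= Num.sqrt (a ^+ 2 + b ^+ 2).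
  by rewrite -sqrtr_sqr ler_wsqrtr // lerDr sqr_ge0.
rewrite (le_trans (ler_normB _ _)) // !normrM mulr2n mulrDl mul1r.
apply: lerD.
  by rewrite (le_trans _ ha) // ler_piMl // cos_max.
by rewrite (le_trans _ hb) // ler_piMl // sin_max.
Qed.

(** Only the smallest frequency and the total weight matter for the integral of
    a trigonometric polynomial against a measure with decaying transform. *)
Lemma Rintegral_trig_poly_decay (eta c T : R) : 0 < eta -> 0 < c ->
  (forall t : R, T <= `|t| ->
     `|fourier mu t| <= (c * (1 / (1 + `|t|) `^ eta))%:C%C) ->
  forall lo hi A f, trig_poly lo hi A f -> 0 <= lo -> T <= lo ->
  `|I f| <= A * (2 * c / (1 + lo) `^ eta).
Proof.
move=> eta0 c0 hT lo hi A f Tf lo0 Tlo.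
have p0 : 0 < (1 + lo) `^ eta by rewrite powR_gt0 // ltr_pwDl.
apply: (Rintegral_trig_poly_le Tf); first by rewrite divr_ge0 ?mulr_ge0 ?ltW.
move=> w phi lw; apply: (le_trans (Rintegral_cos_fourier w phi)).
rewrite -mulrA ler_pM2l //.
have := hT w (le_trans Tlo lw); rewrite lecE /= => /andP[_ h].
apply: (le_trans h); rewrite ler_pM2l // mul1r lef_pV2 ?posrE //.
have w0 : 0 <= `|w| by [].
by apply: ge0_ler_powR; rewrite ?nnegrE ?lerD2l //; lra.
Qed.

Lemma trig_poly_markov lo hi A f : trig_poly lo hi A f ->
  (forall x, 0 <= f x) ->
  measurable (`[0, 1[ `&` [set x | 1 <= f x] : set (measurableTypeR R)) /\
  (mu (`[0%R, 1%R[ `&` [set x | (1 <= f x)%R]) <= (I f)%:E)%E.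
Proof.
move=> Tf f0.
have mf : measurable_fun (`[0%R, 1%R[%classic : set (measurableTypeR R)) f.
  apply: measurable_funTS; apply: measurable_realfun.continuous_measurable_fun.
  exact: trig_poly_continuous Tf.
have int_f := trig_poly_integrable Tf.
split.
  have -> : [set x | 1 <= f x] = f @^-1` `[1, +oo[%classic.
    by apply/seteqP; split => x /=; rewrite in_itv /= andbT.
  exact: mf.
have fin : (\int[mu]_(x in `[0%R, 1%R[) (f x)%:E)%E \is a fin_num.
  exact: integrable_fin_num.
rewrite /Rintegral fineK //.
have h := @le_integral_comp_abse _ _ _ mu (`[0%R, 1%R[%classic) _ (EFin \o f)
   1 id _ _ _ _ ltr01.
have {h} : (1%:E * mu (`[0%R, 1%R[ `&` [set x | (1%:E <= `|(EFin \o f) x|)%E]) <=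
   \int[mu]_(x in `[0%R, 1%R[) `|(EFin \o f) x|)%E.
  apply: h => //.
  exact/measurable_realfun.measurable_EFinP.
rewrite mul1e.
have -> : [set x | (1%:E <= `|(EFin \o f) x|)%E] = [set x | 1 <= f x].
  by apply/seteqP; split => x /=; rewrite lee_fin ger0_norm.
move=> /le_trans; apply.
rewrite le_eqVlt; apply/orP; left; apply/eqP; apply: eq_integral => x _ /=.
by rewrite ger0_norm.
Qed.

End Integral.
End TrigPoly.

(** * Counting near resonances inside a block *)

Section Resonances.
Context {R : realType}.
Implicit Types (y X : R).

Lemma sum_geometric_le y L : 0 <= y -> y < 1 -> \sum_(h < L) y ^+ h <= (1 - y)^-1.
Proof.
move=> y0 y1; have y1' : 0 < 1 - y by lra.
rewrite -[leRHS]mul1r ler_pdivlMr //.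
have := subrX1 y L; have := exprn_ge0 L y0.
set S := \sum_(h < L) _; nra.
Qed.

(** Each distance to n is attained at most twice, which leaves twice a geometric
    series. *)
Lemma sum_pow_absdiff_le y L (n : 'I_L) : 0 <= y -> y < 1 ->
  \sum_(m < L) y ^+ absdiff n m <= 2 / (1 - y).
Proof.
move=> y0 y1.
have yh h : 0 <= y ^+ h by exact: exprn_ge0.
apply: (@le_trans _ _ (\sum_(m < L) \sum_(h < L)
   ((if (n + h == m)%N then y ^+ h else 0) +
    (if (m + h == n)%N then y ^+ h else 0)))).
  apply: ler_sum => m _.
  have hL : (absdiff n m < L)%N.
    by have := ltn_ord n; have := ltn_ord m; rewrite /absdiff; lia.
  rewrite (bigD1 (Ordinal hL)) //= -[leLHS]addr0; apply: lerD; last first.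
    by apply: sumr_ge0 => h _; apply: addr_ge0; case: ifP.
  have [e|e] : (n + absdiff n m = m)%N \/ (m + absdiff n m = n)%N.
      by rewrite /absdiff; lia.
    by rewrite e eqxx lerDl; case: ifP.
  by rewrite e eqxx lerDr; case: ifP.
rewrite exchange_big /=.
apply: (@le_trans _ _ (\sum_(h < L) 2 * y ^+ h)).
  apply: ler_sum => h _.
  rewrite big_split /= -!big_mkcond mulr2n mulrDl mul1r.
  by apply: lerD; apply: sum_subsingleton_le => // i j /eqP ei /eqP ej;
    apply: val_inj => /=; lia.
by rewrite -mulr_sumr ler_wpM2l // sum_geometric_le.
Qed.

Lemma count_le X d : 0 <= X ->
  \sum_(l < d) (if l.+1%:R <= X then 1 else 0) <= X.
Proof.
move=> X0; elim: d => [|d IH]; first by rewrite big_ord0.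
rewrite big_ord_recr /=; case: ifP => [dX|_]; last by rewrite addr0.
apply: le_trans dX; rewrite -natr1 lerD2r.
apply: (@le_trans _ _ (\sum_(l < d) 1)); last by rewrite sumr_const card_ord.
by apply: ler_sum => l _; case: ifP.
Qed.

Variables (q : nat -> R) (r : R).
Hypothesis r1 : 1 < r.
Hypothesis q_gt0 : forall n, (0 < n)%N -> 0 < q n.
Hypothesis q_growth : forall n, (0 < n)%N -> r * q n <= q n.+1.

Lemma lacunary_pow n h : (0 < n)%N -> r ^+ h * q n <= q (n + h)%N.
Proof.
move=> n0; elim: h => [|h IH]; first by rewrite expr0 mul1r addn0.
rewrite exprS -mulrA addnS.
apply: (@le_trans _ _ (r * q (n + h)%N)); last by apply: q_growth; lia.
by apply: ler_wpM2l => //; move: r1; lra.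
Qed.

Lemma lacunary_le n m : (0 < n)%N -> (n <= m)%N -> q n <= q m.
Proof.
move=> n0 nm; have := lacunary_pow (m - n) n0; rewrite subnKC //.
apply: le_trans; rewrite ler_peMl ?exprn_ege1 ?ltW ?q_gt0 //.
Qed.

(** Indices k and l start at 0 and stand for the frequencies k + 1 and l + 1 of
    the arc minorant. *)
Definition near_resonant s (n k m l : nat) : bool :=
  `|k.+1%:R * q (s + n)%N - l.+1%:R * q (s + m)%N| < q s / 2.

Lemma near_resonantC s n k m l :
  near_resonant s n k m l = near_resonant s m l n k.
Proof. by rewrite /near_resonant distrC. Qed.

(** Two values of k for the same l would differ by less than one, so l
    determines k.  Moreover l q_(s+m) is close to k q_(s+n) <= d q_(s+n), and
    q_(s+m) exceeds q_(s+n) by the factor r^(m-n), which bounds l. *)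
Lemma count_near_resonant_le s d n m : (0 < s)%N -> (n <= m)%N ->
  \sum_(k < d) \sum_(l < d) (if near_resonant s n k m l then 1 else 0) <=
  2 * d%:R * r^-1 ^+ (m - n) :> R.
Proof.
move=> s0 nm; rewrite exchange_big /=.
have r0 : 0 < r by exact: lt_trans r1.
have qs := q_gt0 s0.
have qn : q s <= q (s + n)%N by apply: lacunary_le => //; lia.
have qn0 : 0 < q (s + n)%N by lra.
have rh : 0 < r ^+ (m - n) by rewrite exprn_gt0.
apply: le_trans (count_le d _); last first.
  by rewrite !mulr_ge0 // exprn_ge0 // invr_ge0 ltW.
apply: ler_sum => l _; rewrite -big_mkcond.
apply: (@le_trans _ _ (\sum_(k < d | near_resonant s n k m l)
   (if l.+1%:R <= 2 * d%:R * r^-1 ^+ (m - n) then 1 else 0))).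
  apply: ler_sum => k; rewrite /near_resonant ltr_norml => /andP[h1 _].
  case: ifP => // /negbT; rewrite -ltNge exprVn ltr_pdivrMr // => h2.
  have h3 : r ^+ (m - n) * q (s + n)%N <= q (s + m)%N.
    have := @lacunary_pow (s + n)%N (m - n).
    by have -> : (s + n + (m - n) = s + m)%N; [lia|apply; lia].
  have kd : k.+1%:R <= d%:R :> R by rewrite ler_nat.
  have d1 : 1 <= d%:R :> R by
    rewrite ler1n; exact: leq_ltn_trans (leq0n k) (ltn_ord k).
  have : k.+1%:R * q (s + n)%N <= d%:R * q (s + n)%N by rewrite ler_pM2r.
  have : l.+1%:R * (r ^+ (m - n) * q (s + n)%N) <= l.+1%:R * q (s + m)%N.
    by rewrite ler_pM2l ?ltr0n.
  have : 2 * d%:R * q (s + n)%N < l.+1%:R * r ^+ (m - n) * q (s + n)%N.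
    by rewrite ltr_pM2r.
  have : q (s + n)%N <= d%:R * q (s + n)%N by rewrite ler_peMl // ltW.
  by move: h1; lra.
apply: sum_subsingleton_le => //; last by case: ifP.
move=> k k'; rewrite /near_resonant !ltr_norml.
move=> /andP[h1 h2] /andP[h3 h4]; apply: val_inj => /=.
have lt1 (a b : nat) : (a%:R - b%:R) * q (s + n)%N < q s -> (a <= b)%N :> Prop.
  move=> h; rewrite leqNgt; apply/negP => ba.
  have : 1 <= a%:R - b%:R :> R.
    by rewrite lerBrDr addrC natr1 ler_nat.
  move=> /(ler_wpM2r (ltW qn0)); lra.
have e (a : nat) : a.+1%:R * q (s + n)%N = a%:R * q (s + n)%N + q (s + n)%N.
  by rewrite -natr1 mulrDl mul1r.
move: h1 h2 h3 h4; rewrite !e => h1 h2 h3 h4.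
by apply/eqP; rewrite eqn_leq; apply/andP; split; apply: lt1; rewrite mulrBl; lra.
Qed.

Lemma count_all_near_resonant_le s d L : (0 < s)%N ->
  \sum_(i : 'I_L * 'I_d) \sum_(j : 'I_L * 'I_d)
    (if near_resonant s i.1 i.2 j.1 j.2 then 1 else 0) <=
  4 * d%:R * L%:R * (r / (r - 1)) :> R.
Proof.
move=> s0; have r0 : 0 < r by exact: lt_trans r1.
rewrite -(pair_bigA _ (fun n k => \sum_(j : 'I_L * 'I_d)
  (if near_resonant s (n : 'I_L) (k : 'I_d) j.1 j.2 then 1 else 0))) /=.
have -> : 4 * d%:R * L%:R * (r / (r - 1)) =
    \sum_(n < L) 2 * d%:R * (2 / (1 - r^-1)) :> R.
  rewrite sumr_const card_ord -[RHS]mulr_natr; field.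
  by rewrite !gt_eqF ?subr_gt0.
apply: ler_sum => n _.
apply: (@le_trans _ _ (\sum_(m < L) 2 * d%:R * r^-1 ^+ absdiff n m)).
  under eq_bigr => k _.
    rewrite -(pair_bigA _ (fun m l =>
      if near_resonant s n k (m : 'I_L) (l : 'I_d) then 1 else 0)) /=.
    over.
  rewrite exchange_big /=; apply: ler_sum => m _.
  rewrite /absdiff; have [nm|mn] := leqP n m.
    have -> : (n - m = 0)%N by lia.
    exact: count_near_resonant_le.
  have -> : (m - n = 0)%N by lia.
  rewrite exchange_big addn0 /=.
  under eq_bigr => l _ do under eq_bigr => k _ do rewrite near_resonantC.
  by apply: count_near_resonant_le => //; lia.
rewrite -mulr_sumr ler_wpM2l ?mulr_ge0 //.
by apply: sum_pow_absdiff_le; rewrite ?invr_ge0 ?invf_lt1 ?ltW.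
Qed.

End Resonances.

(** * A majorant for avoiding an arc along a block *)

Section BlockMajorant.
Context {R : realType}.
Variables (q : nat -> R) (r : R).
Hypothesis r1 : 1 < r.
Hypothesis q_gt0 : forall n, (0 < n)%N -> 0 < q n.
Hypothesis q_growth : forall n, (0 < n)%N -> r * q n <= q n.+1.

(** The constant by which L D must be multiplied to bound the second moment of
    the block sum; it depends on the lacunarity ratio only.  A block then gains
    the factor 1 - L / (moment_const * D). *)
Definition moment_const : R := 1 + 1024 * (r / (r - 1)).

Lemma moment_const_gt : 32 < moment_const.
Proof.
have h : 0 < r - 1 by rewrite subr_gt0.
rewrite /moment_const.
have -> : r / (r - 1) = 1 + (r - 1)^-1 by field; rewrite gt_eqF.
have : 0 < (r - 1)^-1 by rewrite invr_gt0.
lra.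
Qed.

Lemma moment_const_gt0 : 0 < moment_const.
Proof. by have := moment_const_gt; lra. Qed.

Lemma moment_constE : moment_const = 1 + 1024 * (r / (r - 1)).
Proof. by []. Qed.

(* The numeral 1024 is unary, so unification must not unfold moment_const. *)
Opaque moment_const.

Section Majorant.
Variables (s L D : nat) (delta : R) (b : nat -> R).
Hypotheses (s0 : (0 < s)%N) (D0 : (0 < D)%N) (LD : (L <= D)%N).
Hypothesis b_le : forall k, `|b k| <= 16.

Let d := D.*2.-1.
Let freq (i : 'I_L * 'I_d) : R := i.2.+1%:R * q (s + i.1)%N.
Let phase (i : 'I_L * 'I_d) : R := - (i.2.+1%:R * (2 * pi * delta)).
Let angle i x : R := 2 * pi * (freq i * x) + phase i.
Let osc x := \sum_(i : 'I_L * 'I_d) b i.2 * cos (angle i x).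
Let a : R := (moment_const * D%:R)^-1.
Let near (i j : 'I_L * 'I_d) := near_resonant q s i.1 i.2 j.1 j.2.
Let far x := \sum_(i : 'I_L * 'I_d) \sum_(j : 'I_L * 'I_d) b i.2 * b j.2 / 2 *
  (cos (angle i x + angle j x) +
   (if near i j then 0 else cos (angle i x - angle j x))).

(** Here osc is the block sum without its mean L, so the majorant is the square
    of 1 minus a times the full block sum. *)
Definition majorant x := (1 - a * (L%:R + osc x)) ^+ 2.
(** What is left of the majorant after its constant term and the near-resonant
    differences in osc^2 have been removed: only large frequencies remain. *)
Definition remainder x := - (2 * a * (1 - a * L%:R)) * osc x + a ^+ 2 * far x.

Let sD_gt0 n : (0 < s + n)%N. Proof. by rewrite addn_gt0 s0. Qed.
Let qsn n : 0 < q (s + n)%N. Proof. exact: q_gt0. Qed.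
Let D1 : 1 <= D%:R :> R. Proof. by rewrite ler1n. Qed.
Let a_gt0 : 0 < a.
Proof.
by rewrite invr_gt0 mulr_gt0 ?ltr0n ?moment_const_gt0.
Qed.
Let aD : a * D%:R = moment_const^-1.
Proof.
have Dn0 : D%:R != 0 :> R by rewrite pnatr_eq0 -lt0n.
rewrite /a invfM -mulrA.
by rewrite (mulVf Dn0) mulr1.
Qed.
Let moment_const_le : moment_const^-1 <= 32^-1.
Proof. by rewrite lef_pV2 ?posrE ?ltW ?moment_const_gt ?moment_const_gt0. Qed.
Let LD' : L%:R <= D%:R :> R. Proof. by rewrite ler_nat. Qed.
Let aL_ge0 : 0 <= a * L%:R. Proof. by rewrite mulr_ge0 // ltW. Qed.
Let aL_le1 : a * L%:R <= 1.
Proof.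
have := ler_wpM2l (ltW a_gt0) LD'; rewrite aD.
by have := moment_const_le; lra.
Qed.

Let dD : d%:R <= 2 * D%:R :> R.
Proof. by rewrite -natrM ler_nat /d; lia. Qed.

Let freq_ge i : q s <= freq i.
Proof.
have h : q s <= q (s + i.1)%N by apply: (lacunary_le r1) => //; exact: leq_addr.
by apply: (le_trans h); rewrite /freq ler_peMl ?ler1n // ltW.
Qed.

Let freq_le i : freq i <= 2 * D%:R * q (s + L)%N.
Proof.
have h : q (s + i.1)%N <= q (s + L)%N.
  by apply: (lacunary_le r1) => //; rewrite leq_add2l ltnW.
apply: ler_pM => //; first exact: ltW.
apply: le_trans dD; rewrite ler_nat; exact: ltn_ord.
Qed.

Let top : R := 4 * D%:R * q (s + L)%N.

Let qs0 : 0 < q s. Proof. exact: q_gt0. Qed.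

Let count_pairs (c : R) : 0 <= c ->
  \sum_(i : 'I_L * 'I_d) c <= c * (2 * D%:R * L%:R).
Proof.
move=> c0; rewrite sumr_const card_prod !card_ord -[leLHS]mulr_natr natrM.
by rewrite ler_wpM2l // mulrC ler_wpM2r.
Qed.

Let osc_trig_poly : trig_poly (q s / 2) (top / 2) (32 * D%:R * L%:R) osc.
Proof.
have h : trig_poly (q s / 2) (top / 2) (\sum_(i : 'I_L * 'I_d) 16) osc.
  apply: (@trig_poly_sum _ _ _ _ _ _ (fun=> 16)
    (fun (i : 'I_L * 'I_d) x => b i.2 * cos (angle i x))) => i _.
  have hc : trig_poly (q s / 2) (top / 2) 1 (fun x => cos (angle i x)).
    apply: trig_poly_cos; have := freq_ge i; have := freq_le i; have := qs0.
    move=> h1 h2 h3; rewrite gtr0_norm /top; last by lra.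
    by apply/andP; split; lra.
  apply: (trig_polyW (trig_polyZ (b i.2) hc)) => //.
  by rewrite mulr1.
apply: (trig_polyW h) => //; apply: le_trans (count_pairs _) _ => //; lra.
Qed.

Let aosc : a * (32 * D%:R * L%:R) <= L%:R.
Proof.
have -> : a * (32 * D%:R * L%:R) = (a * D%:R) * (32 * L%:R) by ring.
have L0 : 0 <= 32 * L%:R :> R by rewrite mulr_ge0.
rewrite aD; have := ler_wpM2r L0 moment_const_le; lra.
Qed.

Let angleD i j x : angle i x + angle j x =
  2 * pi * ((freq i + freq j) * x) + (phase i + phase j).
Proof. by rewrite /angle; ring. Qed.
Let angleB i j x : angle i x - angle j x =
  2 * pi * ((freq i - freq j) * x) + (phase i - phase j).
Proof. by rewrite /angle; ring. Qed.

Let far_trig_poly :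
  trig_poly (q s / 2) top ((32 * D%:R * L%:R) ^+ 2) far.
Proof.
have h : trig_poly (q s / 2) top
    (\sum_(i : 'I_L * 'I_d) \sum_(j : 'I_L * 'I_d) 256) far.
  apply: (@trig_poly_sum _ _ _ _ _ _ (fun=> \sum_(j : 'I_L * 'I_d) 256)
    (fun (i : 'I_L * 'I_d) x => \sum_(j : 'I_L * 'I_d) b i.2 * b j.2 / 2 *
  (cos (angle i x + angle j x) +
   (if near i j then 0 else cos (angle i x - angle j x))))) => i _.
  apply: (@trig_poly_sum _ _ _ _ _ _ (fun=> 256)) => j _.
  have h1 := freq_ge i; have h2 := freq_le i.
  have h3 := freq_ge j; have h4 := freq_le j; have h5 := qs0.
  have cD : trig_poly (q s / 2) top 1 (fun x => cos (angle i x + angle j x)).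
    apply: (trig_polyW (A := 1) (f := fun x => cos (2 * pi *
      ((freq i + freq j) * x) + (phase i + phase j)))) => //; last first.
      by move=> x; rewrite angleD.
    apply: trig_poly_cos; rewrite gtr0_norm /top; last by lra.
    by apply/andP; split; lra.
  have cB : trig_poly (q s / 2) top 1
      (fun x => if near i j then 0 else cos (angle i x - angle j x)).
    have [nij|nij] := boolP (near i j).
      exact: (trig_polyW (trig_poly0 _ _)).
    apply: (trig_polyW (A := 1) (f := fun x => cos (2 * pi *
      ((freq i - freq j) * x) + (phase i - phase j)))) => //; last first.
      by move=> x; rewrite angleB.
    apply: trig_poly_cos; move: nij; rewrite /near /near_resonant -leNgt.
    rewrite -/(freq i) -/(freq j) => -> /=.
    by rewrite /top ler_norml; apply/andP; split; lra.
  apply: (trig_polyW (trig_polyZ (b i.2 * b j.2 / 2) (trig_polyD cD cB))) => //.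
  rewrite !normrM [`|2^-1|]gtr0_norm ?invr_gt0 //.
  have : `|b i.2| * `|b j.2| <= 16 * 16 by apply: ler_pM.
  lra.
apply: (trig_polyW h) => //.
apply: (@le_trans _ _ (\sum_(i : 'I_L * 'I_d) 256 * (2 * D%:R * L%:R))).
  by apply: ler_sum => i _; apply: count_pairs; exact: ler0n.
apply: le_trans (count_pairs _) _.
  by apply: mulr_ge0; [exact: ler0n|rewrite !mulr_ge0].
have : 0 <= (D%:R * L%:R) ^+ 2 :> R by exact: sqr_ge0.
lra.
Qed.

Lemma majorant_trig_poly : trig_poly 0 top ((1 + L%:R) ^+ 2) majorant.
Proof.
have T0 : 0 <= top / 2 by rewrite /top !mulr_ge0 // ltW.
have h : trig_poly 0 (top / 2) (1 + L%:R) (fun x => 1 - a * (L%:R + osc x)).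
  have h1 := trig_poly_cst (1 - a * L%:R) (lexx 0) T0.
  have h2 := trig_polyZ (- a) (trig_poly_lo0 osc_trig_poly).
  apply: (trig_polyW (trig_polyD h1 h2)) => [|x]; last by ring.
  have u0 : 0 <= 1 - a * L%:R by rewrite subr_ge0.
  have a0 := ltW a_gt0.
  rewrite normrN !ger0_norm //; apply: lerD => //.
  by rewrite gerBl.
have := trig_poly_lo0 (trig_polyM h h).
have -> : top / 2 + top / 2 = top by field.
by move=> /trig_polyW; apply.
Qed.

Lemma remainder_trig_poly :
  trig_poly (q s / 2) top ((1 + L%:R) ^+ 2) remainder.
Proof.
have T0 : top / 2 <= top.
  by have : 0 <= top; [rewrite /top !mulr_ge0 // ltW|lra].
have h1 := trig_polyZ (- (2 * a * (1 - a * L%:R)))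
  (trig_poly_freqW (lexx _) T0 osc_trig_poly).
have h2 := trig_polyZ (a ^+ 2) far_trig_poly.
apply: (trig_polyW (trig_polyD h1 h2)) => //.
have u0 : 0 <= 1 - a * L%:R by rewrite subr_ge0.
have a0 := ltW a_gt0.
rewrite normrN !ger0_norm ?sqr_ge0 ?mulr_ge0 //.
rewrite -exprMn.
have L0 : 0 <= L%:R :> R by [].
have m0 : 0 <= a * (32 * D%:R * L%:R) by rewrite !mulr_ge0.
have : (a * (32 * D%:R * L%:R)) ^+ 2 <= L%:R ^+ 2.
  by rewrite ler_sqr ?nnegrE.
have : (1 - a * L%:R) * (a * (32 * D%:R * L%:R)) <= 1 * L%:R.
  by apply: ler_pM => //; rewrite gerBl.
lra.
Qed.


Let near_sum x : \sum_(i : 'I_L * 'I_d) \sum_(j : 'I_L * 'I_d)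
   b i.2 * b j.2 / 2 * (if near i j then cos (angle i x - angle j x) else 0)
   <= 1024 * D%:R * L%:R * (r / (r - 1)).
Proof.
have rr : 0 <= r / (r - 1).
  have h : 0 < r - 1 by rewrite subr_gt0.
  by rewrite divr_ge0 ?ltW //; apply: lt_trans r1.
apply: (@le_trans _ _ (\sum_(i : 'I_L * 'I_d) \sum_(j : 'I_L * 'I_d)
    128 * (if near i j then 1 else 0))).
  apply: ler_sum => i _; apply: ler_sum => j _.
  case: ifP => _; last by rewrite !mulr0.
  apply: (le_trans (ler_norm _)).
  rewrite !normrM [`|2^-1|]gtr0_norm ?invr_gt0 //.
  have h1 : `|b i.2| * `|b j.2| <= 16 * 16 by apply: ler_pM.
  have h2 : `|b i.2| * `|b j.2| / 2 <= 128 by lra.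
  by apply: ler_pM => //; exact: cos_max.
under eq_bigr do rewrite -mulr_sumr.
rewrite -mulr_sumr.
have := @count_all_near_resonant_le _ _ _ r1 q_gt0 q_growth s d L s0.
rewrite -/near; set S := \sum_i _ => hS.
have : 4 * d%:R * L%:R * (r / (r - 1)) <=
       4 * (2 * D%:R) * L%:R * (r / (r - 1)).
  by rewrite ler_wpM2r // ler_wpM2r // ler_wpM2l.
lra.
Qed.

Let osc_sqr x : osc x ^+ 2 = far x +
  \sum_(i : 'I_L * 'I_d) \sum_(j : 'I_L * 'I_d)
   b i.2 * b j.2 / 2 * (if near i j then cos (angle i x - angle j x) else 0).
Proof.
rewrite /far -big_split expr2 mulr_suml; apply: eq_bigr => i _.
rewrite mulr_sumr -big_split; apply: eq_bigr => j _ /=.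
rewrite mulrACA cosMcos.
by case: ifP => _; field.
Qed.

(** The near-resonant part is bounded pointwise by its total weight rather than
    integrated, since its frequencies may be arbitrarily small without
    vanishing.  The value of a minimizes 1 - 2 a L + a^2 moment_const L D. *)
Lemma majorant_le x :
  majorant x <= 1 - L%:R / (moment_const * D%:R) + remainder x.
Proof.
have h : a ^+ 2 * (1024 * D%:R * L%:R * (r / (r - 1)) + L%:R ^+ 2) <= a * L%:R.
  have -> : a * L%:R = a ^+ 2 * (moment_const * D%:R * L%:R).
    have aK : a * (moment_const * D%:R) = 1.
      by rewrite /a mulVf // -invr_eq0 gt_eqF.
    have -> : a ^+ 2 * (moment_const * D%:R * L%:R) =
        a * (a * (moment_const * D%:R)) * L%:R.
      by ring.
    by rewrite aK mulr1.
  rewrite ler_wpM2l ?sqr_ge0 // moment_constE.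
  have : L%:R * L%:R <= D%:R * L%:R :> R by rewrite ler_wpM2r.
  lra.
have := ler_wpM2l (sqr_ge0 a) (near_sum x).
rewrite /majorant /remainder.
have -> : (1 - a * (L%:R + osc x)) ^+ 2 =
  (1 - a * L%:R) ^+ 2 - (2 * a * (1 - a * L%:R)) * osc x + a ^+ 2 * osc x ^+ 2.
  by ring.
rewrite osc_sqr.
have -> : L%:R / (moment_const * D%:R) = a * L%:R by rewrite /a mulrC.
move: h; set N := \sum_i _; lra.
Qed.

Hypothesis minorant_le0 : forall u, cos u <= 1 - 4 / D%:R ^+ 2 ->
  1 + \sum_(k < D.*2.-1) b k * cos (k.+1%:R * u) <= 0.

(** Avoidance makes every term of the block sum nonpositive. *)
Lemma majorant_ge1 x :
  (forall n, (s <= n < s + L)%N ->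
     cos (2 * pi * (q n * x - delta)) <= 1 - 4 / D%:R ^+ 2) ->
  1 <= majorant x.
Proof.
move=> avoid.
have : L%:R + osc x <= 0.
  have -> : L%:R + osc x = \sum_(n < L) (1 + \sum_(k < d)
      b k * cos (k.+1%:R * (2 * pi * (q (s + n)%N * x - delta)))).
    rewrite big_split sumr_const card_ord /= pair_bigA; congr (_ + _).
    apply: eq_bigr => -[n k] _ /=; congr (_ * cos _).
    by rewrite /angle /freq /phase /=; ring.
  apply: sumr_le0 => n _; apply: minorant_le0; apply: avoid.
  by rewrite leq_addr ltn_add2l ltn_ord.
move=> h; rewrite /majorant expr2.
have : a * (L%:R + osc x) <= 0 by rewrite mulr_ge0_le0 // ltW.
nra.
Qed.

End Majorant.

Lemma block_majorant (s L D : nat) (delta : R) :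
  (0 < s)%N -> (0 < D)%N -> (L <= D)%N ->
  exists F H : R -> R,
    [/\ forall x, 0 <= F x,
        forall x, (forall n, (s <= n < s + L)%N ->
          cos (2 * pi * (q n * x - delta)) <= 1 - 4 / D%:R ^+ 2) -> 1 <= F x,
        forall x, F x <= 1 - L%:R / (moment_const * D%:R) + H x,
        trig_poly 0 (4 * D%:R * q (s + L)%N) ((1 + L%:R) ^+ 2) F &
        trig_poly (q s / 2) (4 * D%:R * q (s + L)%N) ((1 + L%:R) ^+ 2) H].
Proof.
move=> s0 D0 LD; have [b [b16 bm]] := @arc_minorant R D D0.
exists (majorant s L D delta b), (remainder s L D delta b); split.
- by move=> x; exact: sqr_ge0.
- by move=> x; exact: majorant_ge1.
- by move=> x; exact: majorant_le.
- exact: majorant_trig_poly.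
- exact: remainder_trig_poly.
Qed.

End BlockMajorant.

(** * Riesz products over separated blocks *)

Section Blocks.
Variables (N L b : nat).

(** Blocks of length L alternate with gaps of length L. *)
Definition block_start j := (N + 2 * L * j)%N.
(** The degree follows the index, so that 1 / block_deg is comparable to
    b / n for n in the block. *)
Definition block_deg j := (block_start j %/ b).+1.

Lemma block_start_gt0 j : (0 < N)%N -> (0 < block_start j)%N.
Proof. by move=> N0; rewrite addn_gt0 N0. Qed.

Lemma block_startS j : block_start j.+1 = (block_start j + L + L)%N.
Proof. by rewrite /block_start; lia. Qed.

Lemma block_startN j : (N <= block_start j)%N.
Proof. exact: leq_addr. Qed.

End Blocks.

Section Riesz.
Context {R : realType}.

Lemma bernoulli_le (u : R) p : 0 <= u -> u <= 1 -> 1 - p%:R * u <= (1 - u) ^+ p.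
Proof.
move=> u0 u1; elim: p => [|p IH]; first by rewrite mul0r subr0 expr0.
rewrite exprS -natr1.
have p0 : 0 <= p%:R :> R by [].
have := ler_wpM2l (_ : 0 <= 1 - u) IH; rewrite subr_ge0 => /(_ u1).
have : 0 <= p%:R * u * u by rewrite !mulr_ge0.
lra.
Qed.

(** Bernoulli's inequality turns the gain of a block into a ratio of block
    starts, so that the product over all blocks telescopes. *)
Lemma telescoping_factor (s t : R) p : 0 < s -> 0 <= t ->
  1 - p%:R * (t / s) <= (s / (s + t)) ^+ p.
Proof.
move=> s0 t0; have st : 0 < s + t by lra.
have -> : s / (s + t) = 1 - t / (s + t) by field; rewrite gt_eqF.
apply: le_trans (bernoulli_le _ _ _); last 2 first.
- by rewrite divr_ge0 // ltW.
- by rewrite ler_pdivrMr // mul1r lerDr ltW.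
rewrite lerD2l lerN2 ler_wpM2l // ler_wpM2l // lef_pV2 ?posrE // lerDl //.
Qed.

Variable mu : probability (measurableTypeR R) R.
Local Notation I f := (\int[mu]_(x in `[0, 1[) f x).

Variables (q : nat -> R) (r : R).
Hypothesis r1 : 1 < r.
Hypothesis q_gt0 : forall n, (0 < n)%N -> 0 < q n.
Hypothesis q_growth : forall n, (0 < n)%N -> r * q n <= q n.+1.

Variables (N L b : nat).

Local Notation start := (block_start N L).
Local Notation deg := (block_deg N L b).
Hypotheses (N0 : (0 < N)%N) (b0 : (0 < b)%N).
Hypothesis LbN : (L * b <= N)%N.
Hypothesis bN : (b <= N)%N.
Hypothesis b_moment : 20 * moment_const r <= b%:R.

(* E lo stands for a bound on the integral of any trigonometric polynomial of
   unit weight with frequencies at least lo. *)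
Variables (J : nat) (e : R) (E : R -> R).
Hypothesis e_ge0 : 0 <= e.
Hypothesis deg_le : forall j, (j < J)%N -> 20 * (deg j)%:R <= r ^+ L.
Hypothesis decay : forall lo hi A f, q N / 4 <= lo -> trig_poly lo hi A f ->
  I f <= A * E lo.
Hypothesis err_le : forall j, (j < J)%N ->
  ((1 + L%:R) ^+ 2) ^+ j.+1 * E (q (start j) / 4) <= e.

Lemma block_deg_ge j : (L <= deg j)%N.
Proof.
apply: leqW; rewrite leq_divRL //; apply: leq_trans LbN _.
exact: block_startN.
Qed.

Lemma block_deg_inv j : (deg j)%:R^-1 < b%:R / (start j)%:R :> R.
Proof.
rewrite -[ltRHS]invf_div ltf_pV2 ?posrE ?ltr0n // ?divr_gt0 ?ltr0n //;
  rewrite ?block_start_gt0 //.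
by rewrite ltr_pdivrMr ?ltr0n // -natrM ltr_nat ltn_ceil.
Qed.

Lemma block_deg_le j : (deg j)%:R <= 2 * (start j)%:R / b%:R :> R.
Proof.
rewrite ler_pdivlMr ?ltr0n // -!natrM ler_nat /block_deg.
have := leq_trunc_div (start j) b.
have := leq_trans bN (block_startN N L j).
set s := start j; set t := (s %/ b)%N; lia.
Qed.

Lemma main_term_le j :
  1 - L%:R / (moment_const r * (deg j)%:R) <=
  ((start j)%:R / (start j.+1)%:R) ^+ 5.
Proof.
have -> : (start j.+1)%:R = (start j)%:R + 2 * L%:R :> R.
  by rewrite block_startS -addnA addnn -mul2n natrD natrM.
set s : R := (start j)%:R.
have s0 : 0 < s by rewrite ltr0n block_start_gt0.
have L0 : 0 <= L%:R :> R by [].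
have t0 : 0 <= 2 * L%:R :> R by lra.
apply: le_trans (telescoping_factor 5 s0 t0).
have sv := moment_const_gt0 r1; have Dg := block_deg_le j; rewrite -/s in Dg.
have D0 : 0 < (deg j)%:R :> R by rewrite ltr0n.
have bp : 0 < b%:R :> R by rewrite ltr0n.
have h : moment_const r * (deg j)%:R <= s / 10.
  apply: (@le_trans _ _ (b%:R / 20 * (2 * s / b%:R))).
    by apply: ler_pM => //; [exact: ltW|move: b_moment; lra].
  by rewrite le_eqVlt; apply/orP; left; apply/eqP; field; rewrite gt_eqF.
rewrite lerD2l lerN2.
have -> : 5 * (2 * L%:R / s) = L%:R / (s / 10) :> R by field; rewrite gt_eqF.
by rewrite ler_wpM2l // lef_pV2 ?posrE ?mulr_gt0 // divr_gt0.
Qed.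

(** Induction on the number of blocks.  The product so far has frequencies at
    most a quarter of q at the next block start, whereas the remainder of the
    next block has frequencies at least half of it; their product has no small
    frequency and its integral is an error term.  The main term is controlled
    because the product so far is nonnegative. *)
Lemma riesz_product (delta : R) j : (j <= J)%N ->
  exists Phi : R -> R,
    [/\ forall x, 0 <= Phi x,
        trig_poly 0 (q (start j) / 4) (((1 + L%:R) ^+ 2) ^+ j) Phi,
        forall x, (forall i n, (i < j)%N ->
            (start i <= n < start i + L)%N ->
            cos (2 * pi * (q n * x - delta)) <= 1 - 4 / (deg i)%:R ^+ 2) ->
          1 <= Phi x &
        I Phi <= (N%:R / (start j)%:R) ^+ 5 + j%:R * e].
Proof.
elim: j => [_|j IH jJ].
  exists (fun=> 1); split => //.
  - have h : 0 <= q (start 0) / 4.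
      by rewrite divr_ge0 // ltW // q_gt0 ?block_start_gt0.
    apply: (trig_polyW (trig_poly_cst 1 (lexx 0) h)) => //.
    by rewrite normr1 expr0.
  - rewrite Rintegral_cst // mul1r mul0r addr0 /block_start muln0 addn0.
    rewrite divff ?pnatr_eq0 -?lt0n // expr1n -lee_fin.
    rewrite fineK ?fin_num_measure //; exact: probability_le1.
have [Phi [Phi0 PhiT Phi1 PhiI]] := IH (ltnW jJ).
set s := start j; set D := deg j.
have s0 : (0 < s)%N := block_start_gt0 L j N0.
have [F [H [F0 F1 FH FT HT]]] := block_majorant r1 q_gt0 q_growth delta s0
  (ltn0Sn _ : (0 < D)%N) (block_deg_ge j).
have qs : 0 < q s by exact: q_gt0.
have PFT := trig_poly_lo0 (trig_polyM PhiT FT).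
have PHT := trig_polyM PhiT HT.
have A0 : 0 <= (1 + L%:R) ^+ 2 :> R by exact: sqr_ge0.
exists (fun x => Phi x * F x); split.
- by move=> x; rewrite mulr_ge0.
- rewrite exprSr; apply: trig_poly_freqW PFT => //.
  rewrite block_startS -/s.
  have h1 : q s <= q (s + L)%N by apply: (lacunary_le r1) => //; exact: leq_addr.
  have h2 : r ^+ L * q (s + L)%N <= q (s + L + L)%N.
    by apply: lacunary_pow => //; rewrite addn_gt0 s0.
  have h3 : 20 * D%:R * q (s + L)%N <= r ^+ L * q (s + L)%N.
    by apply: ler_wpM2r; [rewrite (le_trans (ltW qs))|exact: deg_le].
  have h4 : 1 * q (s + L)%N <= D%:R * q (s + L)%N.
    by apply: ler_wpM2r; [rewrite (le_trans (ltW qs))|rewrite ler1n].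
  lra.
- move=> x avoid; rewrite -[leLHS]mulr1; apply: ler_pM => //.
    by apply: Phi1 => i n ij; apply: avoid; exact: ltnW.
  by apply: F1 => n; exact: avoid.
have IP0 : 0 <= I Phi by apply: Rintegral_ge0.
set M := 1 - L%:R / (moment_const r * D%:R) in FH.
have iP := trig_poly_integrable mu PhiT.
have iMP := trig_poly_integrable mu (trig_polyZ M PhiT).
have iPH := trig_poly_integrable mu PHT.
have iPF := trig_poly_integrable mu PFT.
have step : I (fun x => Phi x * F x) <= M * I Phi + I (fun x => Phi x * H x).
  rewrite -RintegralZl // -RintegralD //.
  apply: le_Rintegral => //.
    by have := integrableD _ iMP iPH; apply.
  move=> x _; rewrite [M * _]mulrC -mulrDr ler_wpM2l //.
have hH : I (fun x => Phi x * H x) <= e.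
  have h : q N / 4 <= q s / 2 - q s / 4.
    have : q N <= q s by apply: (lacunary_le r1) => //; exact: block_startN.
    lra.
  apply: (le_trans (decay h PHT)).
  have -> : q s / 2 - q s / 4 = q s / 4 by field.
  by rewrite -exprSr; exact: err_le.
apply: (le_trans step).
set w : R := (s%:R / (start j.+1)%:R) ^+ 5.
have w1 : w <= 1.
  apply: exprn_ile1; first by rewrite divr_ge0.
  rewrite ler_pdivrMr ?ltr0n ?block_start_gt0 // mul1r ler_nat.
  by rewrite block_startS -addnA leq_addr.
have w0 : 0 <= w by rewrite exprn_ge0 // divr_ge0.
have hM : M * I Phi <= w * I Phi by apply: ler_wpM2r => //; exact: main_term_le.
have hw := ler_wpM2l w0 PhiI.
have e1 : w * (N%:R / (start j)%:R) ^+ 5 =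
    (N%:R / (start j.+1)%:R) ^+ 5.
  rewrite /w -exprMn -/s; congr (_ ^+ 5); field.
  by rewrite !pnatr_eq0 -!lt0n s0 block_start_gt0.
have e2 : w * (j%:R * e) <= j%:R * e by rewrite ler_piMl // mulr_ge0.
rewrite mulrDr e1 in hw.
rewrite -[j.+1%:R]natr1 [X in _ <= _ + X]mulrDl mul1r.
lra.
Qed.

End Riesz.

(** * Distance to the integers and elementary growth *)

Section Geometry.
Context {R : realType}.
Implicit Types (x y : R).

Lemma cosD2piz x (m : int) : cos (x + 2 * pi * m%:~R) = cos x.
Proof.
have e n : 2 * pi * n%:R = pi *+ 2 *+ n :> R.
  by rewrite -mulrnA -[RHS]mulr_natr natrM; ring.
case: m => n; first by rewrite -pmulrn e (periodicn (@cosD2pi R)).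
have -> : x + 2 * pi * (Negz n)%:~R = x - pi *+ 2 *+ n.+1.
  by rewrite NegzE mulrNz -pmulrn -e; ring.
by rewrite -[LHS](periodicn (@cosD2pi R) n.+1) subrK.
Qed.

Lemma cos_piquarter_sqr : cos (pi / 4) ^+ 2 = 2^-1 :> R.
Proof.
have := cos_mulr2n (pi / 4 : R).
have -> : pi / 4 *+ 2 = pi / 2 :> R by rewrite -mulr_natr; field.
by rewrite cos_pihalf -mulr_natr => h; lra.
Qed.

(** sin x = 2 sin (x/2) cos (x/2) and the mean value theorem gives another
    cosine; both angles are at most pi/4, where the cosine squared is 1/2. *)
Lemma sin_ge_half x : 0 <= x -> x <= pi / 2 -> x / 2 <= sin x.
Proof.
move=> x0 xpi; have pi0 := pi_gt0 R.
have [xi] : exists2 xi : R, xi \in `[0, x / 2] &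
    sin (x / 2) - sin 0 = cos xi * (x / 2 - 0).
  apply: (@MVT_segment _ sin cos); first by lra.
  by apply: continuous_subspaceT; exact: continuous_sin.
rewrite in_itv /= sin0 !subr0 => /andP[xi0 xi1] e.
have c0 : 0 <= cos (pi / 4) :> R by apply: cos_ge0_pihalf; lra.
have mono (z : R) : 0 <= z -> z <= pi / 4 -> cos (pi / 4) <= cos z.
  move=> z0 z1; rewrite leNgt ltr_cos ?in_itv /=; first by rewrite -leNgt.
    by apply/andP; split; lra.
  by apply/andP; split; lra.
have h1 : cos (pi / 4) <= cos xi by apply: mono; lra.
have h2 : cos (pi / 4) <= cos (x / 2) by apply: mono; lra.
have -> : sin x = sin ((x / 2) *+ 2) by congr sin; rewrite -mulr_natr; field.
rewrite sin_mulr2n e -[leRHS]mulr_natr.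
have h3 : cos (pi / 4) * cos (pi / 4) <= cos (x / 2) * cos xi.
  by apply: ler_pM.
rewrite -expr2 cos_piquarter_sqr in h3.
have x2 : 0 <= x / 2 by lra.
have := ler_wpM2r x2 h3; lra.
Qed.

Lemma cos_gt_near_int (D : nat) y : (0 < D)%N ->
  1 - 4 / D%:R ^+ 2 < cos (2 * pi * y) -> exists m : int, `|y - m%:~R| < 2 / D%:R.
Proof.
move=> D0 hy; have Dp : 0 < D%:R :> R by rewrite ltr0n.
exists (Num.floor (y + 2^-1)); set m := Num.floor _.
have tb : `|y - m%:~R| <= 2^-1.
  have := floor_le_tmp (y + 2^-1); have := floorD1_gt (y + 2^-1).
  rewrite -/m intrD ler_norml => h1 h2; apply/andP; split; lra.
set t := `|y - m%:~R| in tb *.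
have t0 : 0 <= t by exact: normr_ge0.
have pi0 := pi_gt0 R; have pi2 := pi_ge2 R.
have e : cos (2 * pi * y) = 1 - 2 * sin (pi * t) ^+ 2.
  rewrite -(cosD2piz _ (- m)).
  have -> : 2 * pi * y + 2 * pi * (- m)%:~R = 2 * pi * (y - m%:~R).
    by rewrite mulrNz; ring.
  rewrite -cos_norm normrM [`|2 * pi|]gtr0_norm ?mulr_gt0 // -/t.
  have -> : 2 * pi * t = (pi * t) *+ 2 by rewrite -mulr_natr; ring.
  by rewrite cos_mulr2n cos2sin2 -mulr_natr; ring.
have h : t <= sin (pi * t).
  apply: le_trans (sin_ge_half _ _).
  - have := ler_wpM2r t0 pi2; lra.
  - by rewrite mulr_ge0 // ltW.
  - by rewrite ler_pM2l.
have h2 : t ^+ 2 <= sin (pi * t) ^+ 2 by rewrite ler_sqr ?nnegrE // (le_trans t0).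
have D2 : 0 < D%:R ^- 2 :> R by rewrite invr_gt0 exprn_gt0.
have h0 : 0 <= 2 / D%:R :> R by rewrite divr_ge0.
rewrite -ltr_sqr ?nnegrE // expr_div_n.
have -> : 2 ^+ 2 = 4 :> R by rewrite expr2; ring.
rewrite e in hy; lra.
Qed.

End Geometry.

Section Growth.
Context {R : realType}.
Implicit Types (rho M : R).

Lemma expr_ge_linear rho n : 1 <= rho -> 1 + n%:R * (rho - 1) <= rho ^+ n.
Proof.
move=> r1; elim: n => [|n IH]; first by rewrite mul0r addr0 expr0.
have r0 : 0 <= rho by lra.
rewrite exprS -natr1; have := ler_wpM2l r0 IH.
have : 0 <= n%:R * (rho - 1) ^+ 2 by rewrite mulr_ge0 // sqr_ge0.
lra.
Qed.

Lemma near_expr_ge rho M : 1 < rho -> \forall n \near \oo, M <= rho ^+ n.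
Proof.
move=> r1; have u0 : 0 < rho - 1 by lra.
have Mu : 0 <= `|M| / (rho - 1) by rewrite divr_ge0 // ltW.
exists (Num.bound (`|M| / (rho - 1))) => // n /= hn.
apply: le_trans (expr_ge_linear n (ltW r1)).
have : `|M| / (rho - 1) <= n%:R.
  by rewrite (le_trans (ltW (archi_boundP Mu))) // ler_nat.
rewrite ler_pdivrMr // => h; have := ler_norm M; lra.
Qed.

(** Bernoulli applied to the square root of rho gives quadratic growth. *)
Lemma near_expr_ge_succ rho : 1 < rho -> \forall n \near \oo, 1 + n%:R <= rho ^+ n.
Proof.
move=> r1; have s1 : 1 < Num.sqrt rho by rewrite -[ltLHS]sqrtr1 ltr_sqrt //; lra.
set sg := Num.sqrt rho in s1.
have u0 : 0 < sg - 1 by lra.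
have Mu : 0 <= (sg - 1) ^- 2 by rewrite invr_ge0 sqr_ge0.
exists (Num.bound ((sg - 1) ^- 2)) => // n /= hn.
have hn1 : 1 <= n%:R * (sg - 1) ^+ 2.
  rewrite -ler_pdivrMr ?exprn_gt0 // div1r.
  by rewrite (le_trans (ltW (archi_boundP Mu))) // ler_nat.
have -> : rho = sg ^+ 2 by rewrite sqr_sqrtr //; lra.
have n0 : 0 <= n%:R :> R by [].
have v0 : 0 <= n%:R * (sg - 1) by rewrite mulr_ge0 // ltW.
rewrite exprAC; apply: (@le_trans _ _ ((1 + n%:R * (sg - 1)) ^+ 2)).
  have := ler_wpM2l n0 hn1; nra.
rewrite ler_sqr ?nnegrE ?expr_ge_linear ?ltW //; first by lra.
by rewrite exprn_gt0 //; lra.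
Qed.

Lemma near_mul_le_exp2 (a : nat) : \forall k \near \oo, (a * k <= 2 ^ k)%N.
Proof.
have sq k : (4 <= k)%N -> (k * k <= 2 ^ k)%N.
  elim: k => // k IH; rewrite leq_eqVlt => /orP[/eqP <- //|k4].
  have := IH k4; rewrite expnS; nia.
exists (maxn a 4) => // k /=; rewrite geq_max => /andP[ak k4].
by apply: leq_trans (sq k k4); rewrite leq_mul2r ak orbT.
Qed.

End Growth.

(** * Choice of the parameters *)

Lemma exponent_budget (K1 K2 g k j N : nat) : (0 < k)%N ->
  ((K2 + K1 + 2 * g) * k <= N ->
   g * k * 2 * j.+1 + K2 + K1 * k <= N + 2 * (g * k) * j)%N.
Proof.
move=> k0; have : (K2 <= K2 * k)%N by rewrite leq_pmulr.
have -> : (g * k * 2 * j.+1 = 2 * (g * k) * j + 2 * g * k)%N by nia.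
have -> : ((K2 + K1 + 2 * g) * k = K2 * k + K1 * k + 2 * g * k)%N by nia.
move: (2 * g * k)%N (2 * (g * k) * j)%N (K1 * k)%N (K2 * k)%N => a c d e; lia.
Qed.

Lemma scale_budget (g b n0 k N : nat) : (0 < k)%N ->
  ((g * b + 1 + 2 * g + 20 + n0) * k <= N)%N ->
  [/\ (g * k * b <= N)%N, (1 + 2 * (g * k) <= N)%N, (20 <= N)%N & (n0 <= N)%N].
Proof.
move=> k0.
have -> : ((g * b + 1 + 2 * g + 20 + n0) * k =
  g * k * b + k + 2 * (g * k) + 20 * k + n0 * k)%N by nia.
have : (n0 <= n0 * k)%N by rewrite leq_pmulr.
move: (g * k * b)%N (g * k)%N (n0 * k)%N => a c d; split; lia.
Qed.

Section Stage.
Context {R : realType}.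

Variable mu : probability (measurableTypeR R) R.
Variables (q : nat -> R) (r : R).
Hypothesis r1 : 1 < r.
Hypothesis q_gt0 : forall n, (0 < n)%N -> 0 < q n.
Hypothesis q_growth : forall n, (0 < n)%N -> r * q n <= q n.+1.
Variable b : nat.
Hypothesis b0 : (0 < b)%N.
Hypothesis b_moment : 20 * moment_const r <= b%:R.

Variables (eta c T : R).
Hypotheses (eta0 : 0 < eta) (c0 : 0 < c).
Hypothesis fourier_decay : forall t : R, T <= `|t| ->
  `|fourier mu t| <= (c * (1 / (1 + `|t|) `^ eta))%:C%C.

Let rho : R := r `^ eta.
Let rho_gt1 : 1 < rho.
Proof.
have r0 : 0 <= r by apply: ltW; apply: lt_trans r1.
have h : 1 `^ eta < r `^ eta by rewrite gt0_ltr_powR ?nnegrE.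
by rewrite powR1 in h.
Qed.

Let q_lower n : (0 < n)%N -> q 1%N / r * r ^+ n <= q n.
Proof.
move=> n0; have r0 : 0 < r by apply: lt_trans r1.
have := lacunary_pow r1 q_growth n.-1 (ltn0Sn 0).
rewrite add1n prednK //; apply: le_trans.
rewrite -{1}(prednK n0) exprS le_eqVlt; apply/orP; left; apply/eqP.
by field; rewrite gt_eqF.
Qed.

Let c1 : R := (q 1%N / r / 4) `^ eta.
Let c1_gt0 : 0 < c1.
Proof.
have r0 : 0 < r by apply: lt_trans r1.
by rewrite powR_gt0 // !divr_gt0 // q_gt0.
Qed.

Let pow_lower n : (0 < n)%N -> c1 * rho ^+ n <= (1 + q n / 4) `^ eta.
Proof.
move=> n0; have r0 : 0 < r by apply: lt_trans r1.
have q1 : 0 < q 1%N by exact: q_gt0.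
have -> : c1 * rho ^+ n = (q 1%N / r / 4 * r ^+ n) `^ eta.
  rewrite powRM; last 2 first.
  - by rewrite !divr_ge0 // ltW.
  - by rewrite exprn_ge0 // ltW.
  rewrite -(powR_mulrn n (ltW r0)) -(powR_mulrn n (powR_ge0 r eta)).
  by rewrite -!powRrM [eta * _]mulrC.
have := q_lower n0.
have h0 : 0 <= q 1%N / r / 4 * r ^+ n.
  by rewrite mulr_ge0 ?exprn_ge0 ?divr_ge0 // ltW.
have qn : 0 < q n by exact: q_gt0.
move=> h; apply: ge0_ler_powR; rewrite ?nnegrE //; [exact: ltW|lra|lra].
Qed.

(** The decay hypothesis bounds by this the integral of a trigonometric
    polynomial of unit weight whose frequencies are at least lo. *)
Definition error_bound (lo : R) := 2 * c / (1 + lo) `^ eta.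

(** The weights of the products grow like a power of 1 + L per block, while the
    decay improves by rho^(2L) from one block start to the next.  Since 1 + L
    is at most rho^L for large L, the error stays bounded by that of the first
    block, which is of order rho^(-N) up to powers of N. *)
Lemma near_error_le (g : nat) : (0 < g)%N ->
  \forall k \near \oo, forall j,
    ((1 + (g * k)%:R) ^+ 2) ^+ j.+1 *
      error_bound (q (block_start (2 ^ k) (g * k) j) / 4)
    <= ((2 ^ k)%:R ^+ 7)^-1.
Proof.
move=> g0.
have [K2 _ hK2] := near_expr_ge (2 * c / c1) rho_gt1.
have [K1 _ hK1] := near_expr_ge 128 rho_gt1.
have [n0 _ hn0] := near_expr_ge_succ rho_gt1.
have hk := near_mul_le_exp2 (K2 + K1 + 2 * g)%N.
near=> k => j.
have k_gt0 : (0 < k)%N by near: k; exact: nbhs_infty_gt.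
have k_ge : (n0 <= g * k)%N.
  apply: leq_trans (leq_pmull k g0).
  by near: k; exists n0.
have k_exp : ((K2 + K1 + 2 * g) * k <= 2 ^ k)%N by near: k.
set N := (2 ^ k)%N in k_exp *; set L := (g * k)%N in k_ge *.
set s := block_start N L j.
have s0 : (0 < s)%N by rewrite addn_gt0 expn_gt0.
have hL : 1 + L%:R <= rho ^+ L by apply: hn0.
have rho0 : 0 < rho by apply: lt_trans rho_gt1.
have hA : ((1 + L%:R) ^+ 2) ^+ j.+1 <= rho ^+ (L * 2 * j.+1).
  have L0 : 0 <= 1 + L%:R :> R by rewrite addr_ge0.
  have rL0 : 0 <= rho ^+ L by rewrite exprn_ge0 // ltW.
  rewrite exprM (exprM _ L); apply: lerXn2r; rewrite ?nnegrE ?sqr_ge0 //.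
  by apply: lerXn2r; rewrite ?nnegrE.
have p1 := pow_lower s0.
have p0 : 0 < c1 * rho ^+ s by rewrite mulr_gt0 // exprn_gt0.
have N7 : N%:R ^+ 7 = 128 ^+ k :> R.
  by rewrite natrX -exprM mulnC exprM; congr (_ ^+ k); rewrite -natrX.
have hE : error_bound (q s / 4) <= 2 * c / (c1 * rho ^+ s).
  rewrite /error_bound; apply: ler_wpM2l; first by rewrite mulr_ge0 // ltW.
  by rewrite lef_pV2 ?posrE //; exact: lt_le_trans p1.
have h128 : 128 ^+ k <= rho ^+ (K1 * k).
  rewrite exprM; apply: lerXn2r; rewrite ?nnegrE ?exprn_ge0 ?(ltW rho0) //.
  exact: (hK1 K1 (leqnn _)).
have hc : 2 * c <= rho ^+ K2 * c1
  by rewrite -ler_pdivrMr //; exact: (hK2 K2 (leqnn _)).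
have A0 : 0 <= ((1 + L%:R) ^+ 2) ^+ j.+1 :> R.
  by apply: exprn_ge0; exact: sqr_ge0.
apply: (@le_trans _ _ (rho ^+ (L * 2 * j.+1) * (2 * c / (c1 * rho ^+ s)))).
  apply: ler_pM => //.
  by rewrite divr_ge0 ?powR_ge0 // mulr_ge0 // ltW.
rewrite N7 -[leRHS]mul1r ler_pdivlMr ?exprn_gt0 // mulrA.
rewrite mulrAC ler_pdivrMr // mul1r.
apply: (@le_trans _ _ (rho ^+ (L * 2 * j.+1) * (rho ^+ K2 * c1) * rho ^+ (K1 * k))).
  apply: ler_pM => //.
  - by rewrite !mulr_ge0 ?exprn_ge0 ?(ltW rho0) ?(ltW c0).
  - by rewrite ler_wpM2l // exprn_ge0 // ltW.
have -> : rho ^+ (L * 2 * j.+1) * (rho ^+ K2 * c1) * rho ^+ (K1 * k) =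
  c1 * rho ^+ (L * 2 * j.+1 + K2 + K1 * k) by rewrite !exprD; ring.
rewrite ler_pM2l // ler_eXn2l //.
exact: exponent_budget.
Unshelve. all: by end_near. Qed.

(** With N^2 blocks the last index is at least N^2 and at most N^3, so the
    telescoped main term is at most N^(-5), as is the sum of the N^2 errors. *)
Lemma covering_of_params (N L : nat) :
  (0 < N)%N -> (0 < L)%N -> (L * b <= N)%N -> (1 + 2 * L <= N)%N ->
  20 * N%:R ^+ 3 <= r ^+ L -> T <= q N / 4 ->
  (forall j, ((1 + L%:R) ^+ 2) ^+ j.+1 *
      error_bound (q (block_start N L j) / 4) <= (N%:R ^+ 7)^-1) ->
  forall delta, exists B : set (measurableTypeR R),
    [/\ measurable B, (mu B <= (2 / N%:R ^+ 5)%:E)%E &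
      forall x, x \in `[0, 1[ -> ~ B x -> exists (n : nat) (m : int),
        (N <= n <= N ^ 3)%N /\ `|q n * x - delta - m%:~R| < 4 * b%:R / n%:R].
Proof.
move=> N0 L0 LbN LN hr hT herr delta.
have bN : (b <= N)%N by apply: leq_trans LbN; rewrite leq_pmull.
have start_le j : (j <= N ^ 2)%N -> (block_start N L j <= N ^ 3)%N.
  move=> jN; rewrite /block_start expnS.
  have : (2 * L * j <= 2 * L * N ^ 2)%N by rewrite leq_mul2l jN orbT.
  have : (N <= N ^ 2)%N by rewrite expnS expn1 leq_pmulr.
  have : ((1 + 2 * L) * N ^ 2 <= N * N ^ 2)%N by rewrite leq_mul2r LN orbT.
  by rewrite mulnDl mul1n; move: (N ^ 2)%N (2 * L)%N; lia.
have start_lt j : (j < N ^ 2)%N -> (block_start N L j + L + L <= N ^ 3)%N.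
  by move=> jN; rewrite -block_startS; exact: start_le.
have qN : 0 < q N by exact: q_gt0.
have [Phi [Phi0 PhiT Phi1 PhiI]] : exists Phi : R -> R,
    [/\ forall x, 0 <= Phi x,
        trig_poly 0 (q (block_start N L (N ^ 2)) / 4)
          (((1 + L%:R) ^+ 2) ^+ (N ^ 2)) Phi,
        forall x, (forall i n, (i < N ^ 2)%N ->
            (block_start N L i <= n < block_start N L i + L)%N ->
            cos (2 * pi * (q n * x - delta)) <=
              1 - 4 / (block_deg N L b i)%:R ^+ 2) ->
          1 <= Phi x &
        \int[mu]_(x in `[0, 1[) Phi x <=
          (N%:R / (block_start N L (N ^ 2))%:R) ^+ 5 +
          (N ^ 2)%:R * (N%:R ^+ 7)^-1].
  apply: (riesz_product (E := error_bound) r1 q_gt0 q_growth N0 b0 LbN bN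
    b_moment _ _ _ _ _ (leqnn _)) => //.
  - move=> j jN; apply: le_trans hr.
    rewrite ler_wpM2l // -natrX ler_nat /block_deg.
    apply: leq_trans (start_lt j jN); rewrite -addnA -addn1.
    by apply: leq_add; [exact: leq_div|rewrite addn_gt0 L0].
  - move=> lo hi A f hlo Tf.
    have lo0 : 0 <= lo by apply: le_trans hlo; rewrite divr_ge0 // ltW.
    apply: le_trans (ler_norm _) _.
    apply: (Rintegral_trig_poly_decay eta0 c0 fourier_decay Tf lo0).
    exact: le_trans hlo.
have [mB muB] := trig_poly_markov mu PhiT Phi0.
exists (`[0%R, 1%R[ `&` [set x | 1 <= Phi x]); split => //.
- apply: (le_trans muB); rewrite lee_fin; apply: (le_trans PhiI).
  have Np : 0 < N%:R :> R by rewrite ltr0n.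
  have -> : 2 / N%:R ^+ 5 = (N%:R ^+ 5)^-1 + (N%:R ^+ 5)^-1 :> R by ring.
  apply: lerD; last first.
    rewrite natrX le_eqVlt; apply/orP; left; apply/eqP; field.
    by rewrite gt_eqF.
  rewrite -exprVn; apply: lerXn2r; rewrite ?nnegrE ?invr_ge0 ?divr_ge0 //.
  rewrite ler_pdivrMr ?ltr0n ?block_start_gt0 //.
  rewrite mulrC ler_pdivlMr // -natrM ler_nat.
  rewrite mulnn /block_start.
  have : (N ^ 2 <= 2 * L * N ^ 2)%N by rewrite leq_pmull // muln_gt0.
  by move=> h; apply: leq_trans h _; rewrite leq_addl.
move=> x x01 nB.
have notPhi : ~ (1 <= Phi x) by move=> h; apply: nB; split.
apply: contrapT => none; apply: notPhi; apply: Phi1 => i n iN /andP[n1 n2].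
rewrite leNgt; apply/negP => /cos_gt_near_int -/(_ isT)[m hm].
apply: none; exists n, m.
have s0 := block_start_gt0 L i N0.
have n_ge : (N <= n)%N by apply: leq_trans n1; exact: block_startN.
have n_gt0 : (0 < n)%N by exact: leq_trans n_ge.
split.
  rewrite n_ge /=; apply: leq_trans (start_lt i iN).
  by apply: (leq_trans (ltnW n2)); rewrite leq_addr.
apply: (lt_le_trans hm).
have h1 := @block_deg_inv R N L b N0 b0 i.
apply: (@le_trans _ _ (2 * (b%:R / (block_start N L i)%:R))).
  by rewrite ler_pM2l // ltW.
have -> : 4 * b%:R / n%:R = 2 * (b%:R * (2 / n%:R)) :> R by ring.
rewrite ler_pM2l // ler_pM2l ?ltr0n //.
rewrite ler_pdivlMr ?ltr0n // mulrC ler_pdivrMr ?ltr0n // -natrM ler_nat.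
have Ls : (L <= block_start N L i)%N.
  apply: leq_trans (block_startN _ _ _); apply: leq_trans LbN.
  by rewrite leq_pmulr.
by apply: (leq_trans (ltnW n2)); rewrite mul2n -addnn leq_add2l.
Qed.

(** Any gap length g k with r^g >= 16 lets the growth over a gap beat the
    degrees, which are below N^3 = 8^k. *)
Lemma near_covering : \forall k \near \oo,
  forall delta, exists B : set (measurableTypeR R),
    [/\ measurable B, (mu B <= (2 / (2 ^ k)%:R ^+ 5)%:E)%E &
      forall x, x \in `[0, 1[ -> ~ B x -> exists (n : nat) (m : int),
        (2 ^ k <= n <= (2 ^ k) ^ 3)%N /\
        `|q n * x - delta - m%:~R| < 4 * b%:R / n%:R].
Proof.
have [g0 _ hg] := near_expr_ge 16 r1; set g := g0.+1.
have hrg : 16 <= r ^+ g by apply: hg => /=; exact: leqnSn.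
have [n0 _ hn0] := near_expr_ge (4 * T / (q 1%N / r)) r1.
have r0 : 0 < r by apply: lt_trans r1.
have q1 : 0 < q 1%N / r by rewrite divr_gt0 // q_gt0.
have hexp := near_mul_le_exp2 (g * b + 1 + 2 * g + 20 + n0).
have herr := @near_error_le g isT.
near=> k; apply: (@covering_of_params (2 ^ k) (g * k)).
all: have k_gt0 : (0 < k)%N by near: k; exact: nbhs_infty_gt.
all: have k_exp : ((g * b + 1 + 2 * g + 20 + n0) * k <= 2 ^ k)%N by near: k.
all: have [hb hL h20 hN] := scale_budget k_gt0 k_exp.
- by rewrite expn_gt0.
- by rewrite muln_gt0.
- exact: hb.
- exact: hL.
- have h20' : 20 <= (2 ^ k)%:R :> R by rewrite (ler_nat _ 20).
  apply: (@le_trans _ _ ((2 ^ k)%:R ^+ 4)).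
    by rewrite [leRHS]exprS ler_wpM2r // exprn_ge0.
  have -> : (2 ^ k)%:R ^+ 4 = 16 ^+ k :> R.
    by rewrite natrX -exprM mulnC exprM; congr (_ ^+ k); rewrite -natrX.
  have rg0 : 0 <= r ^+ g by apply: exprn_ge0; exact: ltW.
  by rewrite exprM; apply: lerXn2r; rewrite ?nnegrE.
- rewrite ler_pdivlMr // mulrC.
  apply: le_trans (q_lower _); last by rewrite expn_gt0.
  by rewrite [leRHS]mulrC -ler_pdivrMr //; exact: hn0.
- by near: k.
Unshelve. all: by end_near. Qed.

End Stage.

(** * Passage to almost every point *)

Section AlmostEverywhere.
Context {R : realType}.

Variable mu : probability (measurableTypeR R) R.
Variables (q : nat -> R) (r : R).
Hypothesis r1 : 1 < r.
Hypothesis q_gt0 : forall n, (0 < n)%N -> 0 < q n.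
Hypothesis q_growth : forall n, (0 < n)%N -> r * q n <= q n.+1.
Variable b : nat.
Hypothesis b0 : (0 < b)%N.
Hypothesis b_moment : 20 * moment_const r <= b%:R.

Lemma grid_approx (M : nat) (delta : R) : (0 < M)%N ->
  exists (i : nat) (z : int),
    (i < M)%N /\ `|delta - z%:~R - i%:R / M%:R| <= M%:R^-1.
Proof.
move=> M0; have Mp : 0 < M%:R :> R by rewrite ltr0n.
set z := Num.floor delta; set d := delta - z%:~R.
have d0 : 0 <= d by rewrite subr_ge0 floor_le_tmp.
have d1 : d < 1 by rewrite ltrBlDr addrC; have := floorD1_gt delta; rewrite intrD.
have dM0 : 0 <= d * M%:R by rewrite mulr_ge0 // ltW.
have /andP[t0 t1] := truncn_itv dM0.
exists (Num.truncn (d * M%:R)), z; split.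
  rewrite -(ltr_nat R); apply: (le_lt_trans t0).
  by rewrite gtr_pMl.
rewrite -/d; set i := Num.truncn _ in t0 t1 *.
have -> : d - i%:R / M%:R = (d * M%:R - i%:R) / M%:R.
  by field; rewrite gt_eqF.
rewrite normrM [`|_^-1|]gtr0_norm ?invr_gt0 // ler_piMl ?invr_ge0 ?(ltW Mp) //.
rewrite -natr1 in t1; rewrite ger0_norm; lra.
Qed.

Lemma borel_cantelli_exp2 (A : nat -> set (measurableTypeR R)) :
  (forall k, measurable (A k)) ->
  (forall k, mu (A k) <= (2 * 2^-1 ^+ k)%:E)%E ->
  mu (lim_sup_set A) = 0%E.
Proof.
move=> mA muA; apply: lim_sup_set_cvg0 => //.
apply: (@le_lt_trans _ _ 4%:E); last exact: ltry.
apply: lime_le; first by apply: is_cvg_nneseries => n _ _; exact: measure_ge0.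
apply: nearW => n; rewrite big_mkord.
apply: (@le_trans _ _ (\sum_(k < n) (2 * 2^-1 ^+ k)%:E)%E).
  by apply: lee_sum => k _; exact: muA.
rewrite sumEFin lee_fin -mulr_sumr.
have h : \sum_(k < n) 2^-1 ^+ k <= (1 - 2^-1)^-1 :> R.
  by apply: sum_geometric_le; lra.
have e : (1 - 2^-1)^-1 = 2 :> R by field.
rewrite e in h; lra.
Qed.

(** Borel-Cantelli over the scales, with a union bound over a grid of mesh
    1/N^3 at scale N = 2^k.  The mesh is at most 1/n for every index n that
    occurs, which adds 1 to the constant. *)
Lemma ae_approx :
  (exists eta : R, 0 < eta /\
    vinogradov_at_infty (fourier mu) (fun t => 1 / (1 + `|t|) `^ eta)) ->
  {ae mu, forall x : R, x \in `[0, 1[ ->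
    forall (delta : R) (K : nat), exists (n : nat) (m : int),
      (K <= n)%N /\ `|q n * x - delta - m%:~R| < (4 * b%:R + 1) / n%:R}.
Proof.
move=> [eta [eta0 [c [c0 [T hT]]]]].
have [k0 _ hk0] := near_covering r1 q_gt0 q_growth b0 b_moment eta0 c0 hT.
have /choice[B hB] : forall p : nat * nat, exists B : set (measurableTypeR R),
    [/\ measurable B, (mu B <= (2 / (2 ^ p.1)%:R ^+ 5)%:E)%E &
      (k0 <= p.1)%N -> forall x, x \in `[0, 1[ -> ~ B x ->
        exists (n : nat) (m : int),
        (2 ^ p.1 <= n <= (2 ^ p.1) ^ 3)%N /\
        `|q n * x - p.2%:R / ((2 ^ p.1) ^ 3)%:R - m%:~R| < 4 * b%:R / n%:R].
  move=> [k i] /=; have [kk|kk] := leqP k0 k; last first.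
    exists set0; split => //.
    by rewrite measure0 lee_fin divr_ge0.
  have [B [h1 h2 h3]] := hk0 k kk (i%:R / ((2 ^ k) ^ 3)%:R).
  by exists B; split.
pose A k := \big[setU/set0]_(i < (2 ^ k) ^ 3) B (k, i : nat).
have mA k : measurable (A k).
  by apply: bigsetU_measurable => i _; have [] := hB (k, i : nat).
have muA k : (mu (A k) <= (2 * 2^-1 ^+ k)%:E)%E.
  have := @Boole_inequality _ _ _ mu (fun i => B (k, i)) ((2 ^ k) ^ 3).
  move=> /(_ (fun i _ => let: And3 h _ _ := hB (k, i) in h)) /le_trans; apply.
  apply: (@le_trans _ _
     (\sum_(i < (2 ^ k) ^ 3) (2 / (2 ^ k)%:R ^+ 5)%:E)%E).
    by apply: lee_sum => i _; have [] := hB (k, i : nat).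
  rewrite sumEFin lee_fin sumr_const card_ord -[leLHS]mulr_natr.
  rewrite [((2 ^ k) ^ 3)%:R]natrX.
  set N : R := (2 ^ k)%:R.
  have N1 : 1 <= N by rewrite ler1n expn_gt0.
  have N0 : 0 < N by lra.
  have -> : 2^-1 ^+ k = N^-1 by rewrite /N natrX exprVn.
  have -> : 2 / N ^+ 5 * N ^+ 3 = 2 * N^-1 * N^-1 by field; rewrite gt_eqF.
  rewrite ler_piMr ?mulr_ge0 ?invr_ge0 ?(ltW N0) //.
  by rewrite invf_le1.
have null := borel_cantelli_exp2 mA muA.
exists (lim_sup_set A); split => //.
  apply: bigcap_measurable => // k _.
  by apply: bigcup_measurable => j _.
move=> x /= nP; apply: contrapT => notA; apply: nP => x01 delta K.
have [k1 hk1] : exists k1, forall k, (k1 <= k)%N -> ~ A k x.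
  apply: contrapT => h; apply: notA => k1 _; apply: contrapT => h1.
  by apply: h; exists k1 => k kk Ak; apply: h1; exists k.
pose k := maxn k0 (maxn k1 K).
have kk0 : (k0 <= k)%N by rewrite leq_maxl.
have kk1 : (k1 <= k)%N by rewrite /k maxnCA leq_maxl.
have kK : (K <= k)%N by rewrite /k maxnA leq_maxr.
have M0 : (0 < (2 ^ k) ^ 3)%N by rewrite !expn_gt0.
have [i [z [iM hi]]] := grid_approx delta M0.
have nB : ~ B (k, i) x.
  by move=> Bx; apply: (hk1 k kk1); rewrite /A -(bigcup_mkord _ (fun i => B (k, i)));
    exists i.
have [_ _ /(_ kk0 x x01 nB) [n [m [/andP[n1 n2] hn]]]] := hB (k, i).
rewrite /= in n1 n2 hn.
have n0 : (0 < n)%N by apply: leq_trans n1; rewrite expn_gt0.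
exists n, (m - z); split.
  by apply: (leq_trans kK); apply: leq_trans n1; exact/ltnW/ltn_expl.
have np : 0 < n%:R :> R by rewrite ltr0n.
have hM : ((2 ^ k) ^ 3)%:R^-1 <= n%:R^-1 :> R.
  by rewrite lef_pV2 ?posrE ?ltr0n // ler_nat.
rewrite mulrDl mul1r intrB.
move: hn hi; rewrite ltr_norml ler_norml ltr_norml.
move=> /andP[? ?] /andP[? ?]; apply/andP; split; lra.
Qed.

End AlmostEverywhere.

Lemma unbounded_infinite_set (A : set nat) :
  (forall K, exists n, (K <= n)%N /\ A n) -> infinite_set A.
Proof.
move=> h /finite_fsetP[X AX].
have [n [Kn An]] := h (\max_(i <- finmap.enum_fset X) i).+1.
have : (n <= \max_(i <- finmap.enum_fset X) i)%N.
  by apply: (@leq_bigmax_seq _ (finmap.enum_fset X) xpredT id n) => //; move: An; rewrite AX.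
by move=> /(leq_ltn_trans)/(_ Kn); rewrite ltnn.
Qed.

Lemma dist_nearest_int_le (R : realType) (y : R) (m : int) :
  dist_nearest_int y <= `|y - m%:~R|.
Proof.
apply: ge_inf; last by exists m.
by exists 0 => _ [z _ <-].
Qed.

Lemma lacunary_gt0 (R : realType) (q : nat -> R) (r : R) : 1 < r ->
  (forall n, (1 <= n)%N -> r <= q n.+1 / q n) -> 0 < q 1%N ->
  (forall n, (0 < n)%N -> 0 < q n) /\
  (forall n, (0 < n)%N -> r * q n <= q n.+1).
Proof.
move=> r1 hq q1.
have pos n : (0 < n)%N -> 0 < q n.
  elim: n => // -[|n] IH _ //.
  have qn := IH isT; have := hq n.+1 isT.
  rewrite ler_pdivlMr //; apply: lt_le_trans.
  by rewrite mulr_gt0 // (lt_trans _ r1).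
by split=> // n n0; rewrite -ler_pdivlMr ?pos //; exact: hq.
Qed.

Theorem theorem1p1 (R : realType) (q : nat -> R) (hq : lacunary q) :
  exists C : R, 0 < C /\
    forall mu : probability (measurableTypeR R) R,
      mu `[0%R, 1%R[%classic = 1%E ->
      (exists eta : R, 0 < eta /\
         vinogradov_at_infty (fourier mu) (fun t => 1 / (1 + `|t|) `^ eta)) ->
      {ae mu, forall x : R, x \in `[0, 1[ ->
         forall delta : R, delta \in `[0, 1[ ->
           infinite_set [set n : nat | (1 <= n)%N /\
             dist_nearest_int (q n * x - delta) < C / n%:R]}.
Proof.
have [r [r1 hr]] := hq.
have s0 := moment_const_gt0 r1.
pose b := (Num.bound (20 * moment_const r)).
have sb : 20 * moment_const r <= b%:R.
  by apply/ltW/archi_boundP; rewrite mulr_ge0 // ltW.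
have b0 : (0 < b)%N by rewrite -(ltr_nat R); apply: lt_le_trans sb; lra.
exists (4 * b%:R + 1); split; first by rewrite ltr_wpDl.
move=> mu _ decay.
have q1_neq0 : q 1%N != 0.
  apply/eqP => q1; have := hr 1%N isT; rewrite q1 invr0 mulr0; lra.
have [q1|q1] : 0 < q 1%N \/ q 1%N < 0.
  by move: q1_neq0; rewrite neq_lt => /orP[]; [right|left].
  have [q_gt0 q_growth] := lacunary_gt0 r1 hr q1.
  apply: negligibleS (ae_approx r1 q_gt0 q_growth b0 sb decay) => x /= nP hx.
  apply: nP => x01 delta _; apply: unbounded_infinite_set => K.
  have [n [m [Kn hn]]] := hx x01 delta (maxn 1 K).
  move: Kn; rewrite geq_max => /andP[n1 Kn].
  exists n; split => //; split => //.
  exact: le_lt_trans (dist_nearest_int_le _ m) hn.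
have [] := @lacunary_gt0 R (fun n => - q n) r r1.
- by move=> n n1; rewrite invrN mulrNN; exact: hr.
- by rewrite oppr_gt0.
move=> q_gt0 q_growth.
apply: negligibleS (ae_approx r1 q_gt0 q_growth b0 sb decay) => x /= nP hx.
apply: nP => x01 delta _; apply: unbounded_infinite_set => K.
have [n [m [Kn hn]]] := hx x01 (- delta) (maxn 1 K).
move: Kn; rewrite geq_max => /andP[n1 Kn].
exists n; split => //; split => //.
apply: le_lt_trans (dist_nearest_int_le _ (- m)) _.
rewrite -normrN; congr (`|_| < _): hn.
by rewrite mulrNz; ring.
Qed.
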